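(* Fix numbers $Z>0$, $\varepsilon>0$, $0<k_{\min}<k_{\max}$, $R>0$, and a data function $g\in C^{1}[k_{\min},k_{\max}]$. Then: 1. For every $\lambda>0$, every $k\in[k_{\min},k_{\max}]$ and every $(q,r)\in\overline{B(R)}$, the functional $J_\lambda(\cdot,\cdot)(k)$ has a Fréchet derivative $J_\lambda'(q,r)(k)$ (with respect to increments $(h_1,h_2)\in\mathcal H_0$), and $J_\lambda'(q,r)(k)\in\mathcal H_0$. Moreover this derivative is Lipschitz continuous on $\overline{B(R)}$: there exists $D=D(R,\lambda,k)>0$ such that for all $k\in[k_{\min},k_{\max}]$ $$\|J_\lambda'(q_2,r_2)(k)-J_\lambda'(q_1,r_1)(k)\|_{H^2(0,Z)\times H^2(0,Z)}\le D\,\|(q_2,r_2)-(q_1,r_1)\|_{H^2(0,Z)\times H^2(0,Z)}$$ for all $(q_1,r_1),(q_2,r_2)\in\overline{B(R)}$. 2. There exist a sufficiently large number $\lambda_1=\lambda_1(R,Z,k_{\min},k_{\max},\varepsilon)\ge 1$ and a number $C_1=C_1(R,Z,k_{\min},k_{\max},\varepsilon)>0$, depending only on the listed parameters, such that for all $\lambda\ge\lambda_1$ and all $k\in[k_{\min},k_{\max}]$ the functional $J_\lambda(\cdot,\cdot)(k)$ is strongly convex on $\overline{B(R)}$ in the sense that $$J_\lambda(q_2,r_2)(k)-J_\lambda(q_1,r_1)(k)-\big[J_\lambda'(q_1,r_1)(k),(q_2-q_1,r_2-r_1)\big]\ge C_1e^{-2\lambda Z}\|(q_2,r_2)-(q_1,r_1)\|^2_{H^2(0,Z)\times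 H^2(0,Z)}$$ for all $(q_1,r_1),(q_2,r_2)\in\overline{B(R)}$. 3. For each $\lambda\ge\lambda_1$ and each $k\in[k_{\min},k_{\max}]$ there exists a unique minimizer $(q_{\min,\lambda}(\cdot,k),r_{\min,\lambda}(\cdot,k))\in\overline{B(R)}$ of $J_\lambda(\cdot,\cdot)(k)$ on $\overline{B(R)}$, and $$\big[J_\lambda'(q_{\min,\lambda},r_{\min,\lambda})(k),(q-q_{\min,\lambda},r-r_{\min,\lambda})\big]\ge 0\quad\text{for all }(q,r)\in\overline{B(R)}.$$
   Context: Notation: $'$ on functions of $z$ denotes $\partial_z$. $H^2(0,Z)$ is the usual Sobolev space; $[\cdot,\cdot]$ denotes the scalar product in $H^2(0,Z)\times H^2(0,Z)$, i.e. $[(u_1,u_2),(v_1,v_2)]=(u_1,v_1)_{H^2}+(u_2,v_2)_{H^2}$, with the induced norm. For a fixed $k\in[k_{\min},k_{\max}]$ (with $0<k_{\min}<k_{\max}$), $\varepsilon>0$, $Z>0$, define for $(q,r)\in H^2(0,Z)\times H^2(0,Z)$ the nonlinear operators $$L_1(q,r)=q''+\tfrac{2k}{\varepsilon}q'(q'-r')+\tfrac{1}{\varepsilon^2}(q'-r')^2-2\sqrt k\,q'-\tfrac{q'-r'}{\varepsilon\sqrt k},$$ $$L_2(q,r)=r''+\tfrac{2k}{\varepsilon}q'(q'-r')+\tfrac{1}{\varepsilon^2}(q'-r')^2-2\sqrt k\,q'-\tfrac{q'-r'}{\varepsilon\sqrt k}.$$ Given a data function $g$ on $[k_{\min},k_{\max}]$,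 the boundary conditions (BC$_g$) are $q(0)=0$, $q'(0)=2\sqrt k\,g'(k)+\frac{g(k)}{\sqrt k}-\frac{6}{k^{5/2}}$, $q'(Z)=0$, $r(0)=-\varepsilon$, $r'(0)=2\sqrt k\,(g'(k)-\varepsilon g(k))+\frac{g(k)}{\sqrt k}-\frac{6}{k^{5/2}}-\frac{4\varepsilon}{k^{3/2}}$, $r'(Z)=0$. For $\rho>0$, $\overline{B(\rho)}$ (for each fixed $k$) is the set of pairs $(q,r)\in H^2(0,Z)\times H^2(0,Z)$ with $\|q\|_{H^2(0,Z)}+\|r\|_{H^2(0,Z)}\le\rho$ satisfying BC$_g$; $B(\rho)$ is the same set with strict inequality. $\mathcal H_0$ is the closed subspace of pairs $(h_1,h_2)\in H^2(0,Z)\times H^2(0,Z)$ with $h_i(0)=h_i'(0)=h_i'(Z)=0$, $i=1,2$. The Carleman weight is $\varphi_\lambda(z)=e^{-2\lambda z}$, $\lambda\ge1$, and the functional is $$J_\lambda(q,r)(k)=\int_0^Z\big[(L_1(q,r)(z,k))^2+(L_2(q,r)(z,k))^2\big]\varphi_\lambda(z)\,dz.$$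
   Formalization: In part 3, existence of the minimizer is stated assuming the closed ball B(R) for that k is nonempty; it is empty for small R, since r(0) = -ε forces a lower bound on the H² norm of r, and then no minimizer exists. *)

(* Defs.v *)
From HB Require Import structures.
From mathcomp Require Import all_boot all_order all_algebra.
From mathcomp Require Import all_classical all_reals all_analysis.
Set Implicit Arguments. Unset Strict Implicit. Unset Printing Implicit Defensive.
Import Order.TTheory GRing.Theory Num.Theory.
Import numFieldNormedType.Exports.
Local Open Scope classical_set_scope.
Local Open Scope ring_scope.

(* An element of H^2(0,Z) is represented by a triple (u, u', u'') of functions
   R -> R; only their values on [0,Z] matter.  [isH2 Z u] says that u'' is
   square integrable on [0,Z] and that u' and u are obtained by integration,
   i.e. u' is the (absolutely continuous) derivative of u and u'' is the weak
   (= a.e.) derivative of u'.  This is the standard description of H^2(0,Z)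
   in one dimension.  Two triples represent the same element of H^2(0,Z) iff
   the H^2 norm of their difference is 0. *)
Record H2f (R : realType) := MkH2f {
  fv : R -> R;
  fd1 : R -> R;
  fd2 : R -> R   (* u'' *) }.

Section H2.
Context {R : realType}.
Notation mu := (@lebesgue_measure R).

Definition isH2 (Z : R) (u : H2f R) : Prop :=
  measurable_fun `[0, Z] (fd2 u) /\
  mu.-integrable `[0, Z] (fun x => ((fd2 u x) ^+ 2)%:E) /\
  (forall x, 0 <= x <= Z ->
     fd1 u x = fd1 u 0 + \int[mu]_(t in `[0, x]) fd2 u t /\
     fv u x = fv u 0 + \int[mu]_(t in `[0, x]) fd1 u t).

Definition H2add (u v : H2f R) : H2f R :=
  MkH2f (fun x => fv u x + fv v x) (fun x => fd1 u x + fd1 v x)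
        (fun x => fd2 u x + fd2 v x).
Definition H2sub (u v : H2f R) : H2f R :=
  MkH2f (fun x => fv u x - fv v x) (fun x => fd1 u x - fd1 v x)
        (fun x => fd2 u x - fd2 v x).

Definition H2dot (Z : R) (u v : H2f R) : R :=
  \int[mu]_(x in `[0, Z]) (fv u x * fv v x + fd1 u x * fd1 v x
                           + fd2 u x * fd2 v x).
Definition H2norm (Z : R) (u : H2f R) : R := Num.sqrt (H2dot Z u u).

Definition Pair := (H2f R * H2f R)%type.
Definition Padd (a b : Pair) : Pair := (H2add a.1 b.1, H2add a.2 b.2).
Definition Psub (a b : Pair) : Pair := (H2sub a.1 b.1, H2sub a.2 b.2).
Definition Pdot (Z : R) (a b : Pair) : R := H2dot Z a.1 b.1 + H2dot Z a.2 b.2.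
Definition Pnorm (Z : R) (a : Pair) : R := Num.sqrt (Pdot Z a a).

Definition inH0 (Z : R) (h : Pair) : Prop :=
  isH2 Z h.1 /\ isH2 Z h.2 /\
  fv h.1 0 = 0 /\ fd1 h.1 0 = 0 /\ fd1 h.1 Z = 0 /\
  fv h.2 0 = 0 /\ fd1 h.2 0 = 0 /\ fd1 h.2 Z = 0.

Definition C1_on (kmin kmax : R) (g dg : R -> R) : Prop :=
  {within `[kmin, kmax], continuous dg} /\
  (forall k, kmin <= k <= kmax ->
     (fun h => (g (k + h) - g k) / h) @
       within (fun h => kmin <= k + h <= kmax) (0 : R)^' --> dg k).

Definition BC (Z eps : R) (g dg : R -> R) (k : R) (a : Pair) : Prop :=
  let q := a.1 in let r := a.2 in
  fv q 0 = 0 /\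
  fd1 q 0 = 2 * Num.sqrt k * dg k + g k / Num.sqrt k
            - 6 / (k ^+ 2 * Num.sqrt k) /\
  fd1 q Z = 0 /\
  fv r 0 = - eps /\
  fd1 r 0 = 2 * Num.sqrt k * (dg k - eps * g k) + g k / Num.sqrt k
            - 6 / (k ^+ 2 * Num.sqrt k) - 4 * eps / (k * Num.sqrt k) /\
  fd1 r Z = 0.

Definition cBall (Z eps : R) (g dg : R -> R) (k rho : R) (a : Pair) : Prop :=
  isH2 Z a.1 /\ isH2 Z a.2 /\ BC Z eps g dg k a /\
  H2norm Z a.1 + H2norm Z a.2 <= rho.

Definition Lnl (eps k : R) (a : Pair) (z : R) : R :=
  let dq := fd1 a.1 z in let dr := fd1 a.2 z in
  2 * k / eps * dq * (dq - dr) + (dq - dr) ^+ 2 / eps ^+ 2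
  - 2 * Num.sqrt k * dq - (dq - dr) / (eps * Num.sqrt k).

Definition L1 (eps k : R) (a : Pair) (z : R) : R := fd2 a.1 z + Lnl eps k a z.
Definition L2 (eps k : R) (a : Pair) (z : R) : R := fd2 a.2 z + Lnl eps k a z.

(* J_lambda(q,r)(k) with Carleman weight exp(-2 lambda z) *)
Definition Jl (Z eps lam k : R) (a : Pair) : R :=
  \int[mu]_(z in `[0, Z]) ((L1 eps k a z ^+ 2 + L2 eps k a z ^+ 2)
                           * expR (- (2 * lam * z))).

(* d \in H_0 is the Frechet derivative J_lambda'(a)(k), with respect to
   increments in H_0, identified with an element of H_0 via [.,.] *)
Definition isFDer (Z eps lam k : R) (a d : Pair) : Prop :=
  inH0 Z d /\
  forall e : R, 0 < e -> exists delta : R, 0 < delta /\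
    forall h : Pair, inH0 Z h -> Pnorm Z h < delta ->
      `| Jl Z eps lam k (Padd a h) - Jl Z eps lam k a - Pdot Z d h |
        <= e * Pnorm Z h.

End H2.

(* Main.v *)
(* With h = (u, v) in H_0, the Taylor remainder of J at (q, r) is the weighted
   integral of
     2 (L_1 + L_2) Q(h') + (u'' + E(h'))^2 + (v'' + E(h'))^2,
   where Q is quadratic and E(h') = O(|h'|), uniformly for bounded q', r', h'.
   Its modulus is at most C |h|^2 in H^2, and it is at least
     1/2 int (u''^2 + v''^2) phi - A int (1 + q''^2 + r''^2) (u'^2 + v'^2) phi.
   Since u'(0) = 0, Cauchy-Schwarz on u'(z) = int_0^z u'' gives the pointwise
   Carleman estimate u'(z)^2 phi(z) <= 1/(2 lambda) int u''^2 phi, so that for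
   large lambda the second term is absorbed by the first.  This is strong
   convexity; the quadratic upper bound makes the linear part (represented in
   H_0 by Riesz) the Frechet derivative and forces it to be Lipschitz.  A
   minimizing sequence in the ball is then Cauchy by the midpoint inequality. *)
Require Import Defs.
From HB Require Import structures.
From mathcomp Require Import all_boot all_order all_algebra.
From mathcomp Require Import all_classical all_reals all_analysis.
From mathcomp Require Import measurable_realfun.
From mathcomp Require Import ring lra.
Import Order.TTheory GRing.Theory Num.Theory.
Import numFieldNormedType.Exports.
Set Implicit Arguments.
Unset Strict Implicit.
Unset Printing Implicit Defensive.
Local Open Scope classical_set_scope.
Local Open Scope ring_scope.

(** * Semi-inner products: minimizers, Riesz representation, gradients *)

(** Triples at distance zero represent the same function and no quotient is taken, so the abstract
    part works with semi-inner products on submodules; gradients and minimizers are then determined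
    up to norm zero. The obstacle to convexity is that L_1 + L_2, the factor of the quadratic form
    Q(h'), contains q'' and r'', which are merely square integrable. A Carleman bound on the
    integral of u'^2 phi could not absorb such a product; a bound uniform in z can, because the
    density 1 + q''^2 + r''^2 is then integrated by itself, without the weight. The data g enters
    through boundary values only, which cancel in differences of ball elements, and the coefficients
    of the nonlinearity are bounded uniformly on [kmin, kmax]; hence lambda_1 and C_1 depend on
    neither g nor k. The factor exp(-2 lambda Z) is the least value of the weight, lost when the
    weighted norm of u'' is compared with the H^2 norm. The midpoint argument is used twice: on the
    ball for J, and on H_0 for the functional whose minimizer is the Riesz representative. *)

Section SemiInner.
Context {R : realType} {V : lmodType R}.
Implicit Types (W K : set V) (u v w : V) (t : R).

Definition submodule W := W 0 /\ forall t u v, W u -> W v -> W (t *: u + v).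

(** Linearity and positivity are asked on [W] only: the integrals behind the H^2 form are additive
    for square-integrable functions, not for arbitrary triples. Nonzero vectors of norm zero are
    allowed. *)
Definition semi_inner W (dot : V -> V -> R) :=
  [/\ submodule W,
      forall u v, dot u v = dot v u,
      forall t u v w, W u -> W v -> W w ->
        dot (t *: u + v) w = t * dot u w + dot v w &
      forall u, W u -> 0 <= dot u u].

(* Only sequences that converge geometrically are required to have a limit. *)
Definition seq_complete (dot : V -> V -> R) K :=
  forall x : nat -> V, (forall n, K (x n)) ->
    (forall n, dot (x n.+1 - x n) (x n.+1 - x n) <= 8^-1 ^+ n) ->
  exists2 y, K y & forall e, 0 < e ->
    exists N, forall n, (N <= n)%N -> dot (y - x n) (y - x n) < e.

Section Submodule.
Context (W : set V) (sW : submodule W).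

Lemma submodule0 : W 0. Proof. by case: sW. Qed.

Lemma submoduleD u v : W u -> W v -> W (u + v).
Proof. by move=> Wu Wv; rewrite -[u]scale1r; apply: (sW.2). Qed.

Lemma submoduleZ t u : W u -> W (t *: u).
Proof. by move=> Wu; rewrite -[_ *: _]addr0; apply: (sW.2) => //; case: sW. Qed.

Lemma submoduleN u : W u -> W (- u).
Proof. by move=> Wu; rewrite -scaleN1r; apply: submoduleZ. Qed.

Lemma submoduleB u v : W u -> W v -> W (u - v).
Proof. by move=> Wu Wv; apply/submoduleD/submoduleN. Qed.

End Submodule.

Section Dot.
Context (W : set V) (dot : V -> V -> R) (iW : semi_inner W dot).

Let sW : submodule W. Proof. by case: iW. Qed.

Lemma sdotC u v : dot u v = dot v u. Proof. by case: iW. Qed.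

Lemma sdot_ge0 u : W u -> 0 <= dot u u. Proof. by case: iW => _ _ _; apply. Qed.

Lemma sdotDl u v w : W u -> W v -> W w -> dot (u + v) w = dot u w + dot v w.
Proof.
by case: iW => _ _ D _ Wu Wv Ww; rewrite -{1}[u]scale1r D// mul1r.
Qed.

Lemma sdotZl t u w : W u -> W w -> dot (t *: u) w = t * dot u w.
Proof.
case: iW => -[W0 _] _ D _ Wu Ww.
have d0 : dot 0 w = 0.
  have := D 1 0 0 w W0 W0 Ww; rewrite scale1r addr0 mul1r => e.
  by apply: (addIr (dot 0 w)); rewrite add0r -e.
by have := D t u 0 w Wu W0 Ww; rewrite addr0 d0 addr0.
Qed.

Lemma sdotNl u w : W u -> W w -> dot (- u) w = - dot u w.
Proof. by move=> Wu Ww; rewrite -scaleN1r sdotZl// mulN1r. Qed.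

Lemma sdotBl u v w : W u -> W v -> W w -> dot (u - v) w = dot u w - dot v w.
Proof. by move=> Wu Wv Ww; rewrite sdotDl ?sdotNl//; exact: submoduleN. Qed.

Lemma sdotDr u v w : W u -> W v -> W w -> dot w (u + v) = dot w u + dot w v.
Proof. by move=> *; rewrite sdotC sdotDl// ![dot _ w]sdotC. Qed.

Lemma sdotZr t u w : W u -> W w -> dot w (t *: u) = t * dot w u.
Proof. by move=> *; rewrite sdotC sdotZl// ![dot _ w]sdotC. Qed.

Lemma sdotBr u v w : W u -> W v -> W w -> dot w (u - v) = dot w u - dot w v.
Proof. by move=> *; rewrite sdotC sdotBl// ![dot _ w]sdotC. Qed.

Lemma sdotZZ t u : W u -> dot (t *: u) (t *: u) = t ^+ 2 * dot u u.
Proof.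
by move=> Wu; rewrite sdotZl ?sdotZr//; [ring | exact: submoduleZ].
Qed.

Lemma sdotDD u v : W u -> W v ->
  dot (u + v) (u + v) = dot u u + 2 * dot u v + dot v v.
Proof.
move=> Wu Wv; have Wuv := submoduleD sW Wu Wv.
by rewrite sdotDl// !sdotDr// [dot v u]sdotC; ring.
Qed.

Lemma sdotBB u v : W u -> W v ->
  dot (u - v) (u - v) = dot u u - 2 * dot u v + dot v v.
Proof.
move=> Wu Wv; have Wuv := submoduleB sW Wu Wv.
by rewrite sdotBl// !sdotBr// [dot v u]sdotC; ring.
Qed.

Lemma sdot_subC u v : W u -> W v -> dot (u - v) (u - v) = dot (v - u) (v - u).
Proof. by move=> Wu Wv; rewrite !sdotBB// [dot v u]sdotC; ring. Qed.

(** Vectors of norm zero lead to [a = 0], where a nonnegative affine function must have slope 0. The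
    lemma yields both Cauchy-Schwarz and the first-order condition in [riesz]. *)
Lemma quadratic_ge0_discr (a b c : R) :
  0 <= a -> (forall t, 0 <= t ^+ 2 * a + 2 * t * b + c) -> b ^+ 2 <= a * c.
Proof.
move=> a0 H; have [a_eq0|an0] := eqVneq a 0.
  rewrite a_eq0 mul0r; have [->|bn0] := eqVneq b 0; first by rewrite expr0n.
  have := H (- (c + 1) / (2 * b)); rewrite a_eq0.
  rewrite (_ : _ + _ + c = - 1); last by field.
  by rewrite ler0N1.
have a_gt0 : 0 < a by rewrite lt_neqAle eq_sym an0.
have := H (- b / a).
rewrite (_ : _ + _ + c = (a * c - b ^+ 2) / a); last by field.
by rewrite pmulr_lge0 ?invr_gt0// subr_ge0.
Qed.

Lemma sCauchySchwarz u v : W u -> W v -> dot u v ^+ 2 <= dot u u * dot v v.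
Proof.
move=> Wu Wv; apply: quadratic_ge0_discr => [|t]; first exact: sdot_ge0.
have Wtu := submoduleZ sW t Wu.
have := sdot_ge0 (submoduleD sW Wtu Wv).
by rewrite sdotDD// sdotZZ// sdotZl// mulrA.
Qed.

Definition snorm u := Num.sqrt (dot u u).

Lemma snorm_ge0 u : 0 <= snorm u. Proof. exact: sqrtr_ge0. Qed.

Lemma sqr_snorm u : W u -> snorm u ^+ 2 = dot u u.
Proof. by move=> Wu; rewrite sqr_sqrtr// sdot_ge0. Qed.

Lemma snormZ t u : W u -> snorm (t *: u) = `|t| * snorm u.
Proof. by move=> Wu; rewrite /snorm sdotZZ// sqrtrM ?sqr_ge0// sqrtr_sqr. Qed.

Lemma le_sdot_snorm u v : W u -> W v -> `|dot u v| <= snorm u * snorm v.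
Proof.
move=> Wu Wv.
rewrite -ler_sqr ?nnegrE ?mulr_ge0 ?snorm_ge0// exprMn !sqr_snorm//.
by rewrite real_normK ?num_real//; exact: sCauchySchwarz.
Qed.

Lemma ler_snormD u v : W u -> W v -> snorm (u + v) <= snorm u + snorm v.
Proof.
move=> Wu Wv; have Wuv := submoduleD sW Wu Wv.
rewrite -ler_sqr ?nnegrE ?addr_ge0 ?snorm_ge0// sqr_snorm// sdotDD//.
rewrite sqrrD !sqr_snorm// lerD2r lerD2l -[leRHS]mulr_natl ler_pM2l//.
exact: le_trans (ler_norm _) (le_sdot_snorm Wu Wv).
Qed.

(** The midpoint stays above the infimum, so the gain [c * dot (a - b) (a - b)] is at most the mean
    excess of [F] at the two points: near-minimizers are close together. The last hypothesis is
    lower semicontinuity, applied at the limit. *)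
Lemma midpoint_minimizer K (F : V -> R) (c m0 : R) :
  K `<=` W -> K !=set0 -> 0 < c ->
  (forall a, K a -> m0 <= F a) ->
  (forall a b, K a -> K b -> K (2^-1 *: (a + b)) /\
    F (2^-1 *: (a + b)) <= (F a + F b) / 2 - c * dot (a - b) (a - b)) ->
  seq_complete dot K ->
  (forall a, K a -> forall e, 0 < e -> exists2 del, 0 < del &
     forall b, K b -> dot (a - b) (a - b) < del -> F a <= F b + e) ->
  exists2 a, K a & forall b, K b -> F a <= F b.
Proof.
move=> KW [a0 Ka0] c0 Fm0 mid cK lsc.
pose S := [set F a | a in K].
have hS : has_inf S.
  split; first by exists (F a0), a0.
  by exists m0 => _ [a Ka <-]; exact: Fm0.
have mS a : K a -> inf S <= F a.
  by move=> Ka; apply: ge_inf; [case: hS | exists a].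
(* With this error the midpoint inequality gives consecutive terms the rate 8^-n of
   [seq_complete]. *)
have /choice[x xP] n : exists a, K a /\ F a < inf S + c * 8^-1 ^+ n.
  have [|_ [a Ka <-] Fa] := @inf_adherent _ S (c * 8^-1 ^+ n) _ hS.
    by rewrite mulr_gt0 ?exprn_gt0 ?invr_gt0.
  by exists a.
have {}cK : exists2 y, K y & forall e, 0 < e ->
    exists N, forall n, (N <= n)%N -> dot (y - x n) (y - x n) < e.
  apply: cK => n; first by case: (xP n).
  have [Kn Fn] := xP n; have [Kn1 Fn1] := xP n.+1.
  have [Km Fm] := mid _ _ Kn1 Kn.
  rewrite -(ler_pM2l c0).
  have := mS _ Km.
  have : c * 8^-1 ^+ n.+1 <= c * 8^-1 ^+ n.
    by rewrite ler_pM2l// exprS ler_piMl ?exprn_ge0 ?invr_ge0 ?invf_le1 ?ler1n.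
  lra.
have [y Ky yx] := cK; exists y => // b Kb.
apply: le_trans (mS _ Kb); apply/ler_addgt0Pr => e e0.
have e20 : 0 < e / 2 by rewrite divr_gt0.
have [del del0 Hd] := lsc _ Ky _ e20.
have [N HN] := yx _ del0.
have [M HM] : exists M, forall n, (M <= n)%N -> c * 8^-1 ^+ n <= e / 2.
  have h : 0 < e / 2 / c by rewrite divr_gt0.
  have : (fun n => (8^-1 : R) ^+ n) @ \oo --> (0 : R).
    by apply: cvg_expr; rewrite ger0_norm ?invf_lt1 ?ltr1n.
  move=> /cvgrPdist_le/(_ _ h) [M _ HM]; exists M => n Mn.
  have := HM n Mn; rewrite sub0r normrN ger0_norm ?exprn_ge0//.
  by rewrite ler_pdivlMr// mulrC.
have [Kn Fn] := xP (maxn N M).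
have h1 := Hd _ Kn (HN _ (leq_maxl _ _)); have h2 := HM _ (leq_maxr N M).
lra.
Qed.

(** The representative minimizes [dot u u - 2 * l u], which is at least -C^2; its midpoint
    inequality is the parallelogram law, an equality with constant 1/4. *)
Lemma riesz (l : V -> R) (C : R) :
  seq_complete dot W ->
  (forall t u v, W u -> W v -> l (t *: u + v) = t * l u + l v) ->
  (forall u, W u -> `|l u| <= C * snorm u) ->
  exists2 d, W d & forall h, W h -> dot d h = l h.
Proof.
move=> cW ll lC.
have [W0 _] := sW.
have l0 : l 0 = 0.
  have := ll 1 0 0 W0 W0; rewrite scale1r addr0 mul1r => e.
  by apply: (addIr (l 0)); rewrite add0r -e.
have lD u v : W u -> W v -> l (u + v) = l u + l v.
  by move=> Wu Wv; rewrite -[u]scale1r ll// scale1r mul1r.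
have lZ t u : W u -> l (t *: u) = t * l u.
  by move=> Wu; have := ll t u 0 Wu W0; rewrite l0 !addr0.
pose F u := dot u u - 2 * l u.
have FE u v : W u -> W v ->
    F v - F u = dot (v - u) (v - u) + 2 * (dot u (v - u) - l (v - u)).
  move=> Wu Wv; rewrite /F -scaleN1r (lD v)// ?lZ//; last exact: submoduleZ.
  by rewrite scaleN1r sdotBB// sdotBr// [dot v u]sdotC; ring.
have [||||||d Wd dmin] := @midpoint_minimizer W F (1/4) (- C ^+ 2) _ _ _ _ _ cW.
- by [].
- by exists 0.
- by rewrite divr_gt0.
- move=> a Wa; rewrite /F -sqr_snorm//.
  have := lC _ Wa; have := ler_norm (l a); have := sqr_ge0 (snorm a - C).
  by rewrite sqrrB; nra.
- move=> a b Wa Wb; have Wab := submoduleD sW Wa Wb; split.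
    exact: submoduleZ.
  rewrite /F sdotZZ// lZ// lD// sdotDD// sdotBB//.
  by rewrite le_eqVlt; apply/orP; left; apply/eqP; field.
- move=> a Wa e e0.
  (* F a - F b is at most 2 (|a| + |C|) |b - a|; the extra 1 keeps the divisor positive. *)
  pose A := 2 * (snorm a + `|C|) + 1.
  have A0 : 0 < A.
    by rewrite ltr_wpDl// mulr_ge0// addr_ge0// snorm_ge0.
  exists ((e / A) ^+ 2); first by rewrite exprn_gt0// divr_gt0.
  move=> b Wb hb; have Wba := submoduleB sW Wb Wa.
  rewrite -lerBlDl -opprB lerNl.
  rewrite FE//.
  have nb : snorm (b - a) <= e / A.
    rewrite -ler_sqr ?nnegrE ?snorm_ge0 ?divr_ge0 ?ltW// sqr_snorm//.
    by rewrite sdot_subC// ltW.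
  have h1 := le_sdot_snorm Wa Wba.
  have h2 := lC _ Wba.
  have h3 : C * snorm (b - a) <= `|C| * snorm (b - a).
    by rewrite ler_wpM2r ?snorm_ge0// ler_norm.
  have h4 := sdot_ge0 Wba.
  have h5 : A * snorm (b - a) <= e by rewrite mulrC -ler_pdivlMr.
  have h6 := snorm_ge0 (b - a).
  move: h1 h2; rewrite !ler_norml => /andP[h1 _] /andP[_ h2].
  by move: h5; rewrite /A; nra.
(* F (d + t h) - F d is a nonnegative quadratic in t without constant term, so the discriminant
   bound kills its linear coefficient [dot d h - l h]. *)
exists d => // h Wh; apply/eqP; rewrite -subr_eq0 -sqrf_eq0 eq_le sqr_ge0 andbT.
rewrite -[leRHS](mulr0 (dot h h)).
apply: quadratic_ge0_discr => [|t]; first exact: sdot_ge0.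
have Wth := submoduleZ sW t Wh.
have := dmin _ (submoduleD sW Wd Wth).
rewrite -subr_ge0 FE//; last exact: submoduleD.
rewrite [d + _ - d]addrC addKr sdotZZ// sdotZr// lZ//.
by congr (0 <= _); ring.
Qed.

(** The choice t n = w balances the two squares and produces the factor 2. If w = 0, a small
    positive length s = t n with C s < n is used instead and contradicts n > 0. *)
Lemma le_of_small_scaling (n w C M : R) : 0 <= n -> 0 <= w -> 0 < C ->  0 < M -> w <= M ->
  (forall t, 0 <= t -> t * n <= M -> t * n ^+ 2 <= C * ((t * n) ^+ 2 + w ^+ 2)) ->
  n <= 2 * C * w.
Proof.
move=> n0 w0 C0 M0 wM H.
have [n_eq0|nn0] := eqVneq n 0; first by rewrite n_eq0 !mulr_ge0// ltW.
have n_gt0 : 0 < n by rewrite lt_neqAle eq_sym nn0.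
have [w_eq0|wn0] := eqVneq w 0.
  have [s [s0 sM sC]] : exists s, [/\ 0 < s, s <= M & C * s < n].
    exists (Num.min M (n / (2 * C))); split.
    - by rewrite lt_min M0 divr_gt0// mulr_gt0.
    - by rewrite ge_min lexx.
    - rewrite (@le_lt_trans _ _ (n / 2))//; last by lra.
      rewrite -ler_pdivlMl// ge_min; apply/orP; right.
      by rewrite le_eqVlt; apply/orP; left; apply/eqP; field; rewrite gt_eqF.
  have := H (s / n); rewrite divfK ?gt_eqF// w_eq0 expr0n addr0.
  move=> /(_ (divr_ge0 (ltW s0) n0) sM).
  rewrite (_ : _ * n ^+ 2 = s * n); last by field.
  by rewrite expr2 mulrCA ler_pM2l// leNgt sC.
have w_gt0 : 0 < w by rewrite lt_neqAle eq_sym wn0.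
have := H (w / n); rewrite divfK// => /(_ (divr_ge0 w0 n0) wM).
rewrite (_ : _ * n ^+ 2 = w * n); last by field.
rewrite (_ : C * _ = w * (2 * C * w)); last by ring.
by rewrite ler_pM2l.
Qed.

(* Comparing the first order expansions of [F] at [a1] and [a2] with each other
   bounds [dot (d2 - d1) h] by the three quadratic remainders. *)
Lemma gradient_lipschitz (H : set V) (F : V -> R) (C M : R) a1 a2 d1 d2 :
  submodule H -> H `<=` W -> 0 < C -> 0 < M ->
  W a1 -> W a2 -> H (a2 - a1) -> H d1 -> H d2 -> snorm (a2 - a1) <= M ->
  (forall h, H h -> snorm h <= 2 * M ->
     `|F (a1 + h) - F a1 - dot d1 h| <= C * dot h h) ->
  (forall h, H h -> snorm h <= 2 * M ->
     `|F (a2 + h) - F a2 - dot d2 h| <= C * dot h h) ->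
  snorm (d2 - d1) <= 8 * C * snorm (a2 - a1).
Proof.
move=> sH HW C0 M0 Wa1 Wa2 Hw Hd1 Hd2 wM E1 E2.
set w := a2 - a1 in Hw wM *; set d := d2 - d1.
have Hd : H d by exact: submoduleB.
rewrite (_ : 8 * C = 2 * (4 * C)); last by ring.
apply: (@le_of_small_scaling _ _ (4 * C) M) => //; rewrite ?snorm_ge0 ?mulr_gt0//.
move=> t t0 tM.
have Hh := submoduleZ sH t Hd; set h := t *: d in Hh.
have nh : snorm h = t * snorm d by rewrite snormZ ?ger0_norm//; exact: HW.
have Hwh := submoduleD sH Hw Hh.
have nwh : snorm (w + h) <= 2 * M.
  by rewrite (le_trans (ler_snormD (HW _ Hw) (HW _ Hh)))// nh; lra.
have e1 := E1 _ Hw; have e2 := E1 _ Hwh; have e3 := E2 _ Hh.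
have {}e1 := e1 (le_trans wM _); have {}e1 := e1 ltac:(lra).
have {}e2 := e2 nwh; have {}e3 := e3 ltac:(rewrite nh; lra).
(* The expansions at [a1] and at [a2] end at the same point, so all values of [F] cancel and only
   [dot (d2 - d1) h] is left. *)
have a12 : a1 + w = a2 by rewrite /w addrC subrK.
have a12h : a1 + (w + h) = a2 + h by rewrite addrA a12.
rewrite a12 in e1; rewrite a12h in e2.
have Ww := HW _ Hw; have Wh := HW _ Hh; have Wd := HW _ Hd.
have Wd1 := HW _ Hd1; have Wd2 := HW _ Hd2.
have dE : t * snorm d ^+ 2 = dot d2 h - dot d1 h.
  by rewrite sqr_snorm// -sdotBl// -/d sdotZr.
have wh : dot (w + h) (w + h) <= 2 * dot w w + 2 * dot h h.
  rewrite sdotDD//; have := sdot_ge0 (submoduleB sW Ww Wh); rewrite sdotBB//; lra.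
rewrite -nh dE !sqr_snorm//.
move: e1 e2 e3; rewrite sdotDr// !ler_norml.
move=> /andP[e1 e1'] /andP[e2 e2'] /andP[e3 e3'].
have h0 := sdot_ge0 Wh; have w0 := sdot_ge0 Ww.
have := ler_wpM2l (ltW C0) wh.
have := mulr_ge0 (ltW C0) h0; have := mulr_ge0 (ltW C0) w0.
nra.
Qed.

Lemma snorm_convex t u v : W u -> W v -> 0 <= t <= 1 ->
  snorm (u + t *: (v - u)) <= (1 - t) * snorm u + t * snorm v.
Proof.
move=> Wu Wv /andP[t0 t1].
rewrite (_ : u + _ = (1 - t) *: u + t *: v); last first.
  by rewrite scalerBl scale1r scalerBr addrAC addrA.
apply: le_trans (ler_snormD (submoduleZ sW _ Wu) (submoduleZ sW _ Wv)) _.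
by rewrite !snormZ// !ger0_norm// subr_ge0.
Qed.

Lemma snorm0_dot u v : W u -> W v -> snorm u = 0 -> dot u v = 0.
Proof.
move=> Wu Wv u0; apply/eqP; rewrite -normr_le0.
by rewrite (le_trans (le_sdot_snorm Wu Wv))// u0 mul0r.
Qed.

(** Scale [u] to norm 1; if its norm is zero, large multiples force [l u = 0]. A crude bound by sums
    of squares thereby becomes the linear bound that [riesz] asks for. *)
Lemma le_snorm_of_quadratic (l : V -> R) (C : R) : 0 <= C ->
  (forall t u, W u -> l (t *: u) = t * l u) ->
  (forall u, W u -> `|l u| <= C * (1 + dot u u)) ->
  forall u, W u -> `|l u| <= 2 * C * snorm u.
Proof.
move=> C0 lZ lC u Wu; have H t : 0 < t -> t * `|l u| <= C * (1 + (t * snorm u) ^+ 2).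
  move=> t0; have := lC _ (submoduleZ sW t Wu).
  by rewrite lZ// normrM gtr0_norm// sdotZZ// exprMn sqr_snorm.
have [u0|u0] := eqVneq (snorm u) 0; last first.
  have u_gt0 : 0 < snorm u by rewrite lt_neqAle eq_sym u0 snorm_ge0.
  have := H (snorm u)^-1; rewrite invr_gt0 => /(_ u_gt0).
  rewrite mulVf// expr1n ler_pdivrMl//.
  by move/le_trans; apply; rewrite le_eqVlt; apply/orP; left; apply/eqP; ring.
rewrite u0 mulr0 leNgt; apply/negP => l0.
have := H ((C + 1) / `|l u|) (divr_gt0 (ltr_wpDl C0 ltr01) l0).
by rewrite divfK ?gt_eqF// u0 mulr0 expr0n addr0; lra.
Qed.

(** Test both expansions on t w with w = d' - d and n = |w|: with tolerance n / 4 and C t <= 1/4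
    they give t n^2 <= t n^2 / 2, so n = 0. *)
Lemma frechet_unique (H : set V) (F : V -> R) (C M : R) a d d' :
  submodule H -> H `<=` W -> 0 < M -> 0 < C -> H d -> H d' ->
  (forall h, H h -> snorm h <= M -> `|F (a + h) - F a - dot d h| <= C * dot h h) ->
  (forall e, 0 < e -> exists del, 0 < del /\ forall h, H h -> snorm h < del ->
     `|F (a + h) - F a - dot d' h| <= e * snorm h) ->
  forall h, H h -> dot d' h = dot d h.
Proof.
move=> sH HW M0 C0 Hd Hd' Fd Fd' h Hh.
have Hw := submoduleB sH Hd' Hd; set w := d' - d in Hw.
have Ww := HW _ Hw; have Wd := HW _ Hd; have Wd' := HW _ Hd'; have Wh := HW _ Hh.
suff w0 : snorm w = 0.
  by apply/eqP; rewrite -subr_eq0 -sdotBl//; apply/eqP; exact: snorm0_dot.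
apply/eqP; case: ltgtP (snorm_ge0 w) => // n0 _.
set n := snorm w in n0.
have [del [del0 Hdel]] := Fd' _ (divr_gt0 n0 (ltr0n _ 4)).
pose t := Num.min (del / (2 * n)) (Num.min (M / n) (1 / (4 * C))).
have t0 : 0 < t by rewrite !lt_min !divr_gt0// mulr_gt0.
have Ht := submoduleZ sH t Hw; have Wt := HW _ Ht.
have nt : snorm (t *: w) = t * n by rewrite snormZ// gtr0_norm.
have h1 : t * n < del.
  rewrite -ltr_pdivlMr// gt_min; apply/orP; left.
  by rewrite ltr_pM2l// ltf_pV2 ?posrE ?mulr_gt0//; lra.
have h2 : t * n <= M.
  by rewrite -ler_pdivlMr// !ge_min lexx orbT.
have h3 : C * t <= 1 / 4.
  have : t <= 1 / (4 * C) by rewrite !ge_min lexx !orbT.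
  by move/(ler_wpM2l (ltW C0)); rewrite (_ : C * (1 / (4 * C)) = 1 / 4)//; field; rewrite gt_eqF.
have e1 := Fd _ Ht ltac:(by rewrite nt).
have e2 := Hdel _ Ht ltac:(by rewrite nt).
rewrite nt in e2; rewrite -sqr_snorm// nt in e1.
have e3 : dot d' (t *: w) - dot d (t *: w) = t * n ^+ 2.
  by rewrite -sdotBl// sdotZr// sqr_snorm.
move: e1 e2; rewrite !ler_norml => /andP[e11 e12] /andP[e21 e22].
have tn0 : 0 < t * n by rewrite mulr_gt0.
have : t * n * n <= t * n * (n / 4 + C * t * n) by nra.
rewrite ler_pM2l//; have := ler_wpM2r (ltW n0) h3; lra.
Qed.

End Dot.

Lemma semi_inner_sub W H dot : semi_inner W dot -> submodule H -> H `<=` W ->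
  semi_inner H dot.
Proof.
move=> [sW dC dL d0] sH HW; split=> // [t u v w Hu Hv Hw|u Hu].
  by apply: dL; exact: HW.
by apply: d0; exact: HW.
Qed.

End SemiInner.

(** * Square integrable functions *)

Section SquareIntegrable.
Context d (T : measurableType d) (R : realType).
Context (mu : {measure set T -> \bar R}) (D : set T) (mD : measurable D).
Implicit Types f g : T -> R.

Definition integ f := mu.-integrable D (EFin \o f).

Definition sq_integ f := measurable_fun D f /\ integ (fun x => f x ^+ 2).

(** The algebra of multipliers: it contains the weight and the first derivatives of H^2 functions,
    and multiplication by it preserves [integ] and [sq_integ]. *)
Definition bd_meas f :=
  measurable_fun D f /\ exists M, forall x, D x -> `|f x| <= M.

Definition l2dot f g := \int[mu]_(x in D) (f x * g x).

Lemma le_integ f g : measurable_fun D f -> integ g ->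
  (forall x, D x -> `|f x| <= g x) -> integ f.
Proof.
move=> mf ig fg; apply: (le_integrable mD _ _ ig); first exact/measurable_EFinP.
by move=> x Dx /=; rewrite lee_fin (le_trans (fg x Dx))// ler_norm.
Qed.

Lemma integ_measurable f : integ f -> measurable_fun D f.
Proof. by move=> /measurable_int/measurable_EFinP. Qed.

Lemma integD f g : integ f -> integ g -> integ (fun x => f x + g x).
Proof. by move=> fi gi; have := integrableD mD fi gi. Qed.

Lemma integB f g : integ f -> integ g -> integ (fun x => f x - g x).
Proof. by move=> fi gi; have := integrableB mD fi gi. Qed.

Lemma integZ t f : integ f -> integ (fun x => t * f x).
Proof. by move=> fi; have := integrableZl mD t fi. Qed.

Lemma integ_norm f : integ f -> integ (fun x => `|f x|).
Proof. exact: integrable_norm. Qed.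

Lemma bd_measM_integ f g : bd_meas f -> integ g -> integ (fun x => f x * g x).
Proof.
move=> [mf [M fM]] ig.
apply: (@le_integ _ (fun x => `|M| * `|g x|)) => [||x Dx].
- by apply: measurable_funM => //; exact: integ_measurable.
- exact/integZ/integ_norm.
- by rewrite normrM ler_wpM2r// (le_trans (fM _ Dx))// ler_norm.
Qed.

Lemma bd_measD f g : bd_meas f -> bd_meas g -> bd_meas (fun x => f x + g x).
Proof.
move=> [mf [M fM]] [mg [N gN]]; split; first exact: measurable_funD.
by exists (M + N) => x Dx; rewrite (le_trans (ler_normD _ _))// lerD ?fM ?gN.
Qed.

Lemma bd_measM f g : bd_meas f -> bd_meas g -> bd_meas (fun x => f x * g x).
Proof.
move=> [mf [M fM]] [mg [N gN]]; split; first exact: measurable_funM.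
by exists (M * N) => x Dx; rewrite normrM ler_pM ?fM ?gN.
Qed.

Lemma bd_meas_cst t : bd_meas (fun=> t).
Proof. by split=> //; exists `|t|. Qed.

Lemma bd_measZ t f : bd_meas f -> bd_meas (fun x => t * f x).
Proof. by move=> bf; apply: bd_measM => //; exact: bd_meas_cst. Qed.

Lemma bd_measB f g : bd_meas f -> bd_meas g -> bd_meas (fun x => f x - g x).
Proof.
move=> bf bg; have := bd_measD bf (bd_measZ (-1) bg).
by under eq_fun do rewrite mulN1r.
Qed.

Lemma bd_measX f n : bd_meas f -> bd_meas (fun x => f x ^+ n).
Proof.
move=> bf; elim: n => [|n ih]; first exact: bd_meas_cst.
by under eq_fun do rewrite exprS; exact: bd_measM.
Qed.

Lemma sq_integM f g : sq_integ f -> sq_integ g -> integ (fun x => f x * g x).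
Proof.
move=> [mf f2] [mg g2]; apply: (@le_integ _ (fun x => f x ^+ 2 + g x ^+ 2)).
- exact: measurable_funM.
- exact: integD.
- move=> x Dx; have := sqr_ge0 (`|f x| - `|g x|).
  rewrite -(real_normK (num_real (f x))) -(real_normK (num_real (g x))) normrM.
  have := mulr_ge0 (normr_ge0 (f x)) (normr_ge0 (g x)); nra.
Qed.

Lemma sq_integZ t f : sq_integ f -> sq_integ (fun x => t * f x).
Proof.
move=> [mf f2]; split; first exact: measurable_funM.
by under eq_fun do rewrite exprMn; exact: integZ.
Qed.

Lemma sq_integD f g : sq_integ f -> sq_integ g -> sq_integ (fun x => f x + g x).
Proof.
move=> sf sg; have [mf f2] := sf; have [mg g2] := sg.
split; first exact: measurable_funD.
have := integD (integD f2 g2) (integZ 2 (sq_integM sf sg)).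
by congr integ; apply/funext => x; ring.
Qed.

Lemma sq_integB f g : sq_integ f -> sq_integ g -> sq_integ (fun x => f x - g x).
Proof.
move=> sf sg; have := sq_integD sf (sq_integZ (-1) sg).
by under eq_fun do rewrite mulN1r.
Qed.

Lemma bd_measM_sq_integ f g : bd_meas f -> sq_integ g ->
  sq_integ (fun x => f x * g x).
Proof.
move=> bf [mg g2]; split; first by apply: measurable_funM => //; case: bf.
by under eq_fun do rewrite exprMn; apply: bd_measM_integ => //; exact: bd_measX.
Qed.

Lemma sq_integ_norm f : sq_integ f -> sq_integ (fun x => `|f x|).
Proof.
move=> [mf f2]; split; first exact: measurableT_comp.
by under eq_fun do rewrite real_normK ?num_real//.
Qed.

Lemma l2_semi_inner : semi_inner (sq_integ : set (T -> R)) l2dot.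
Proof.
split.
- split=> [|t f g sf sg].
    split; first exact: measurable_cst.
    rewrite /integ (_ : EFin \o _ = cst 0%E); first exact: integrable0.
    by apply/funext => x /=; rewrite expr0n.
  by apply: (sq_integD (sq_integZ t sf) sg).
- by move=> f g; apply: eq_Rintegral => x _; rewrite mulrC.
- move=> t f g h sf sg sh; rewrite /l2dot -RintegralZl//; last exact: sq_integM.
  rewrite -RintegralD//; [|exact/integZ/sq_integM|exact: sq_integM].
  by apply: eq_Rintegral => x _; rewrite mulrA -mulrDl.
- by move=> f _; apply: Rintegral_ge0 => x _; rewrite -expr2 sqr_ge0.
Qed.

Lemma dist_geometric_cauchy (u : nat -> R) (c : R) : 0 <= c ->
  (forall n, `|u n.+1 - u n| <= c * 2^-1 ^+ n) ->
  exists l, u @ \oo --> l /\ forall n, `|l - u n| <= 2 * c * 2^-1 ^+ n.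
Proof.
move=> c0 H.
have Hm n k : `|u (n + k)%N - u n| <= 2 * c * 2^-1 ^+ n - 2 * c * 2^-1 ^+ (n + k).
  elim: k => [|k ih]; first by rewrite addn0 !subrr normr0.
  rewrite addnS -[X in `|X|](subrKA (u (n + k)%N)).
  apply: le_trans (ler_normD _ _) _.
  apply: le_trans (lerD (H _) ih) _.
  by rewrite exprS le_eqVlt; apply/orP; left; apply/eqP; field.
have Hn n m : (n <= m)%N -> `|u m - u n| <= 2 * c * 2^-1 ^+ n.
  move=> nm; have := Hm n (m - n)%N; rewrite subnKC// => /le_trans; apply.
  by rewrite gerBl !mulr_ge0// exprn_ge0// invr_ge0.
have cu : cvgn u.
  apply/cauchy_cvgP/cauchy_exP => e e0.
  have [N HN] : exists N, 2 * c * 2^-1 ^+ N < e.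
    have : (fun n => 2 * c * (2^-1 : R) ^+ n) @ \oo --> 2 * c * 0.
      by apply: cvgM; [exact: cvg_cst|apply: cvg_expr]; rewrite ger0_norm ?invf_lt1 ?ltr1n.
    rewrite mulr0 => /cvgrPdist_lt/(_ _ e0) [N _ HN]; exists N.
    by have := HN N (leqnn N); rewrite /= sub0r normrN => /(le_lt_trans (ler_norm _)).
  exists (u N); exists N => // m Nm; rewrite /= -ball_normE /= distrC.
  exact: le_lt_trans (Hn _ _ Nm) HN.
exists (limn u); split=> // n.
have : (fun m => `|u m - u n|) @ \oo --> `|limn u - u n|.
  by apply: cvg_norm; apply: cvgB => //; exact: cvg_cst.
move=> hl; apply: (@closed_cvg _ _ _ eventually_filter (fun m => `|u m - u n|)
  (fun z => z <= 2 * c * 2^-1 ^+ n)) hl.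
- exact: closed_le.
- by exists n => // m nm; exact: Hn.
Qed.

(* Riesz-Fischer: with [G = sum_n 4^n (x_(n+1) - x_n)^2], which has a finite
   integral, consecutive terms are at distance at most [sqrt G / 2^n] wherever
   [G] is finite, and the limit [y] satisfies [(y - x_n)^2 <= 4 G / 4^n]. *)
Lemma l2_complete : seq_complete l2dot (sq_integ : set (T -> R)).
Proof.
move=> x sx dx.
have sB n : sq_integ (x n.+1 - x n) by exact: sq_integB.
(* The rate 8^-n of the squared distances leaves room for the factor 4^n: the n-th integral is at
   most 2^-n, and the sum at most 2. *)
pose h n t : \bar R := (4 ^+ n * (x n.+1 t - x n t) ^+ 2)%:E.
have h0 n t : (0 <= h n t)%E.
  by rewrite lee_fin mulr_ge0 ?sqr_ge0// exprn_ge0.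
have ih n : mu.-integrable D (h n) by apply: integZ; case: (sB n).
have mh n : measurable_fun D (h n) by exact: measurable_int (ih n).
pose G t : \bar R := (\sum_(0 <= n <oo) h n t)%E.
have G0 t : (0 <= G t)%E by exact: nneseries_ge0.
have mG : measurable_fun D G by exact: ge0_emeasurable_sum.
have IG : (\int[mu]_(t in D) G t <= 2%:E)%E.
  rewrite integral_nneseries//; apply: lime_le.
    by apply: is_cvg_nneseries => n _ _; exact: integral_ge0.
  apply: nearW => n; rewrite (@le_trans _ _ (\sum_(0 <= i < n) (2^-1 ^+ i)%:E)%E)//.
    apply: lee_sum => i _.
    rewrite -[leLHS]fineK; last exact: integrable_fin_num.
    rewrite lee_fin -/(Rintegral mu D (fun t => 4 ^+ i * (x i.+1 t - x i t) ^+ 2)).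
    rewrite RintegralZl//; last by case: (sB i).
    have -> : (2^-1 : R) ^+ i = 4 ^+ i * 8^-1 ^+ i.
      by rewrite -exprMn; congr (_ ^+ _); field.
    by rewrite ler_wpM2l ?exprn_ge0//; exact: dx.
  rewrite sumEFin lee_fin.
  suff -> : \sum_(0 <= i < n) (2^-1 : R) ^+ i = 2 - 2 * 2^-1 ^+ n.
    by rewrite gerBl mulr_ge0// exprn_ge0// invr_ge0.
  elim: n => [|n ih']; first by rewrite big_geq// expr0 mulr1 subrr.
  by rewrite big_nat_recr//= ih' exprS; field.
pose A := D `&` [set t | G t \is a fin_num].
have mA : measurable A by exact: emeasurable_fin_num.
have /choice[y yP] t : exists l, A t ->
    x ^~ t @ \oo --> l /\ forall n, `|l - x n t| <= 2 * Num.sqrt (fine (G t)) * 2^-1 ^+ n.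
  have [[Dt Gt]|nA] := pselect (A t); last by exists 0.
  have [|n|l Hl] := @dist_geometric_cauchy (x ^~ t) (Num.sqrt (fine (G t))); last by exists l.
    exact: sqrtr_ge0.
  rewrite -ler_sqr ?nnegrE ?mulr_ge0 ?sqrtr_ge0 ?exprn_ge0 ?invr_ge0//.
  rewrite exprMn sqr_sqrtr ?fine_ge0// real_normK ?num_real// -exprM mulnC exprM.
  rewrite (_ : 2^-1 ^+ 2 = 4^-1 :> R); last by field.
  rewrite exprVn ler_pdivlMr ?exprn_gt0// -lee_fin fineK// mulrC.
  have := @nneseries_lim_ge R (h ^~ t) predT 0 n.+1 (fun n _ _ => h0 n t).
  apply: le_trans; rewrite big_nat_recr//=.
  by rewrite leeDr// sume_ge0.
pose f := y \_ A.
have mf : measurable_fun D f.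
  apply: (@measurable_realfun.measurable_fun_cvg _ _ _ _ (fun m => x m \_ A)).
    move=> m; apply/measurable_restrict => //.
    by apply: measurable_funS (sx m).1 => // t [].
  move=> t Dt; rewrite /f patchE; case: ifPn => tA.
    rewrite (_ : (fun m => (x m \_ A) t) = x ^~ t); last first.
      by apply/funext => m; rewrite patchE tA.
    by case: (yP t (set_mem tA)).
  rewrite (_ : (fun m => (x m \_ A) t) = cst 0); first exact: cvg_cst.
  by apply/funext => m; rewrite patchE (negbTE tA).
(* Where [G] is infinite so is the right-hand side; the inequality therefore holds at every point of
   [D] and can be integrated directly. *)
have key n t : D t -> (((f t - x n t) ^+ 2)%:E <= (4 * 4^-1 ^+ n)%:E * G t)%E.
  move=> Dt; have [Gt|] := boolP (G t \is a fin_num); last first.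
    rewrite fin_numE negb_and !negbK => /orP[/eqP GE|/eqP ->].
      by have := G0 t; rewrite GE.
    by rewrite gt0_muley ?leey// lte_fin mulr_gt0// exprn_gt0// invr_gt0.
  have At : A t by [].
  have [_ /(_ n) ye] := yP t At.
  rewrite -[G t]fineK// -EFinM lee_fin /f patchE mem_set//.
  rewrite -real_normK ?num_real//.
  have -> : 4 * 4^-1 ^+ n * fine (G t) = (2 * Num.sqrt (fine (G t)) * 2^-1 ^+ n) ^+ 2.
    rewrite !exprMn sqr_sqrtr ?fine_ge0// -exprM mulnC exprM.
    rewrite (_ : 2^-1 ^+ 2 = 4^-1 :> R); last by field.
    by ring.
  by rewrite ler_sqr ?nnegrE// (le_trans _ ye).
have mfx n : measurable_fun D (fun t => f t - x n t).
  by apply: measurable_funB => //; case: (sx n).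
have keyI n : (\int[mu]_(t in D) ((f t - x n t) ^+ 2)%:E <= (8 * 4^-1 ^+ n)%:E)%E.
  apply: (@le_trans _ _ (\int[mu]_(t in D) ((4 * 4^-1 ^+ n)%:E * G t))%E).
    apply: ge0_le_integral => //.
    - by move=> t _; rewrite lee_fin sqr_ge0.
    - by apply/measurable_EFinP; exact: measurable_funX.
    - exact: measurable_funeM.
    - exact: key.
  rewrite ge0_integralZl// ?lee_fin ?mulr_ge0 ?exprn_ge0 ?invr_ge0//.
  apply: (@le_trans _ _ ((4 * 4^-1 ^+ n)%:E * 2%:E)%E).
    by rewrite lee_wpmul2l// lee_fin mulr_ge0// exprn_ge0// invr_ge0.
  by rewrite -EFinM lee_fin mulrAC -natrM.
have sfx n : sq_integ (fun t => f t - x n t).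
  split; first exact: mfx.
  rewrite /integ; apply/integrableP; split.
    by apply/measurable_EFinP; exact: measurable_funX.
  under eq_integral do rewrite /= ger0_norm ?sqr_ge0//.
  exact: le_lt_trans (keyI n) (ltry _).
exists f.
  by have := sq_integD (sfx 0%N) (sx 0%N); congr sq_integ; apply/funext => t /=; rewrite subrK.
move=> e e0.
have : (fun n => 8 * (4^-1 : R) ^+ n) @ \oo --> (8 * 0 : R).
  by apply: cvgM; [exact: cvg_cst|apply: cvg_expr]; rewrite ger0_norm ?invf_lt1 ?ltr1n.
rewrite mulr0 => /cvgrPdist_lt/(_ _ e0) [N _ HN]; exists N => n Nn.
have := HN n Nn; rewrite /= sub0r normrN ger0_norm ?mulr_ge0 ?exprn_ge0 ?invr_ge0//.
apply: le_lt_trans; rewrite -lee_fin (le_trans _ (keyI n))//.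
rewrite /l2dot /Rintegral fineK.
  by under eq_integral do rewrite /= -expr2.
apply: integrable_fin_num => //.
by have := (sfx n).2; congr (mu.-integrable D _); apply/funext => t /=; rewrite expr2.
Qed.

End SquareIntegrable.

(** * Integrability on sets of finite measure *)

Section FiniteMeasure.
Context d (T : measurableType d) (R : realType).
Context (mu : {measure set T -> \bar R}) (D : set T) (mD : measurable D).
Hypothesis finD : (mu D < +oo)%E.
Implicit Types f g : T -> R.

Lemma bd_meas_integ f : bd_meas D f -> integ mu D f.
Proof.
move=> [mf [M fM]]; apply: measurable_bounded_integrable => //.
exists M; split; first exact: num_real.
by move=> N MN t Dt /=; rewrite (le_trans (fM _ Dt))// ltW.
Qed.

Lemma bd_meas_sq_integ f : bd_meas D f -> sq_integ mu D f.
Proof. by move=> bf; split; [case: bf|exact/bd_meas_integ/bd_measX]. Qed.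

Lemma sq_integ_integ f : sq_integ mu D f -> integ mu D f.
Proof.
move=> sf; have := sq_integM mD sf (bd_meas_sq_integ (bd_meas_cst D 1)).
by under eq_fun do rewrite mulr1.
Qed.

End FiniteMeasure.

(** * Primitives on [0, Z] *)

Section Primitive.
Context {R : realType}.
Notation mu := (@lebesgue_measure R).
Context (Z : R) (hZ : 0 < Z).
Implicit Types f g : R -> R.

Notation D := `[0, Z]%classic.
Notation l2 := (l2dot mu D).

Definition primitive_on f g :=
  forall x, 0 <= x <= Z -> f x = f 0 + \int[mu]_(t in `[0, x]) g t.

Lemma measure_itv0Z : (mu : {measure set (measurableTypeR R) -> \bar R}) D = Z%:E.
Proof.
by apply: (etrans (lebesgue_measure_itv _)); rewrite /= lte_fin hZ oppr0 adde0.
Qed.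

Lemma measure_itv0Z_lty :
  ((mu : {measure set (measurableTypeR R) -> \bar R}) D < +oo)%E.
Proof. by rewrite measure_itv0Z ltry. Qed.

Lemma Rintegral_itv_cst (c : R) : \int[mu]_(t in D) c = Z * c.
Proof. by rewrite Rintegral_cst// measure_itv0Z mulrC. Qed.

Lemma subitv0 x : 0 <= x <= Z -> `[0, x] `<=` D.
Proof. by move=> /andP[x0 xZ]; apply: subset_itvl; rewrite bnd_simp. Qed.

Lemma integ_subitv g x : 0 <= x <= Z -> integ mu D g -> integ mu `[0, x] g.
Proof. by move=> x0Z; apply: integrableS => //; exact: subitv0. Qed.

Lemma le_Rintegral_subitv g x : 0 <= x <= Z -> integ mu D g ->
  (forall t, D t -> 0 <= g t) ->
  \int[mu]_(t in `[0, x]) g t <= \int[mu]_(t in D) g t.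
Proof.
move=> x0Z ig g0; rewrite /Rintegral fine_le//.
- by apply: integrable_fin_num => //; exact: (integ_subitv x0Z).
- exact: integrable_fin_num.
- apply: ge0_subset_integral => //; first exact: measurable_int ig.
  exact: subitv0.
Qed.

Lemma primitive_on_dist f g x : primitive_on f g -> integ mu D g ->
  0 <= x <= Z -> `|f x - f 0| <= \int[mu]_(t in D) `|g t|.
Proof.
move=> fg ig x0Z; rewrite fg// [f 0 + _]addrC addrK.
apply: le_trans (le_normr_Rintegral _ _) _ => //; first exact: (integ_subitv x0Z).
by apply: le_Rintegral_subitv => //; exact: integ_norm.
Qed.

Lemma primitive_on_bd_meas f g : primitive_on f g -> integ mu D g -> bd_meas D f.
Proof.
move=> fg ig; split; last first.
  exists (`|f 0| + \int[mu]_(t in D) `|g t|) => x.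
  rewrite /= in_itv/= => x0Z.
  rewrite -[f x](subrK (f 0)) addrC (le_trans (ler_normD _ _))// lerD2l.
  exact: primitive_on_dist.
have mD : measurable D by [].
apply: (@eq_measurable_fun _ _ _ _ _
    (fun x => f 0 + parameterized_integral mu 0 x g)).
  by move=> x; rewrite inE/= in_itv/= => x0Z; rewrite (fg _ x0Z).
apply: measurable_funD => //.
apply: subspace_continuous_measurable_fun => //.
by apply: parameterized_integral_continuous => //; exact: ltW.
Qed.

Lemma primitive_on_lin t f g f' g' : integ mu D g -> integ mu D g' ->
  primitive_on f g -> primitive_on f' g' ->
  primitive_on (fun x => t * f x + f' x) (fun x => t * g x + g' x).
Proof.
move=> ig ig' fg fg' x x0Z; rewrite fg// fg'//.
have igx := integ_subitv x0Z ig; have igx' := integ_subitv x0Z ig'.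
rewrite RintegralD//; last exact: integZ.
by rewrite RintegralZl//; ring.
Qed.

Lemma integ_cst0Z (c : R) : integ mu D (fun=> c).
Proof.
by apply: bd_meas_integ => //; [exact: measure_itv0Z_lty|exact: bd_meas_cst].
Qed.

Lemma sq_integ_integ0Z g : sq_integ mu D g -> integ mu D g.
Proof. by move=> sg; apply: sq_integ_integ => //; exact: measure_itv0Z_lty. Qed.

Lemma bd_meas_sq_integ0Z g : bd_meas D g -> sq_integ mu D g.
Proof. by move=> sg; apply: bd_meas_sq_integ => //; exact: measure_itv0Z_lty. Qed.

Lemma l1_le_l2 g : sq_integ mu D g ->
  (\int[mu]_(t in D) `|g t|) ^+ 2 <= Z * \int[mu]_(t in D) g t ^+ 2.
Proof.
move=> sg; have s1 := bd_meas_sq_integ0Z (bd_meas_cst D 1).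
have mD : measurable (D : set (measurableTypeR R)) by [].
have := sCauchySchwarz (l2_semi_inner mu mD) s1 (sq_integ_norm sg).
rewrite /l2dot mulr1 Rintegral_itv_cst mulr1.
under eq_Rintegral do rewrite mul1r.
by under [X in _ * X]eq_Rintegral do rewrite -expr2 real_normK ?num_real//.
Qed.

Lemma primitive_on_dist_sqr f g x : primitive_on f g -> sq_integ mu D g ->
  0 <= x <= Z -> (f x - f 0) ^+ 2 <= Z * \int[mu]_(t in D) g t ^+ 2.
Proof.
move=> fg sg x0Z; apply: le_trans (l1_le_l2 sg).
have h := primitive_on_dist fg (sq_integ_integ0Z sg) x0Z.
rewrite -[leLHS]real_normK ?num_real// lerXn2r ?nnegrE//.
exact: le_trans (normr_ge0 _) h.
Qed.

Lemma primitive_on_sqr_le f g x : primitive_on f g -> sq_integ mu D g ->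
  0 <= x <= Z -> f x ^+ 2 <= 2 * f 0 ^+ 2 + 2 * Z * \int[mu]_(t in D) g t ^+ 2.
Proof.
move=> fg sg x0Z; have := primitive_on_dist_sqr fg sg x0Z.
by have := sqr_ge0 (f x - 2 * f 0); nra.
Qed.

Lemma int_primitive_on_sqr_le f g : primitive_on f g -> sq_integ mu D g ->
  \int[mu]_(t in D) f t ^+ 2 <=
  Z * (2 * f 0 ^+ 2 + 2 * Z * \int[mu]_(t in D) g t ^+ 2).
Proof.
move=> fg sg; rewrite -Rintegral_itv_cst.
have bf := primitive_on_bd_meas fg (sq_integ_integ0Z sg).
apply: le_Rintegral => //.
- by case: (bd_meas_sq_integ0Z bf).
- exact: integ_cst0Z.
- by move=> x; rewrite /= in_itv/= => x0Z; exact: primitive_on_sqr_le.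
Qed.

(* f(x)^2 <= 2 f(y)^2 + 2 (f(x) - f(y))^2, integrated in y. *)
Lemma primitive_on_sobolev f g x : primitive_on f g -> sq_integ mu D g ->
  0 <= x <= Z -> f x ^+ 2 <=
    (2 / Z + 8 * Z) * (\int[mu]_(t in D) f t ^+ 2 + \int[mu]_(t in D) g t ^+ 2).
Proof.
move=> fg sg x0Z.
have sf := bd_meas_sq_integ0Z (primitive_on_bd_meas fg (sq_integ_integ0Z sg)).
set F := \int[mu]_(t in D) f t ^+ 2; set G := \int[mu]_(t in D) g t ^+ 2.
have F0 : 0 <= F by apply: Rintegral_ge0 => t _; exact: sqr_ge0.
have G0 : 0 <= G by apply: Rintegral_ge0 => t _; exact: sqr_ge0.
(* Both f x and f y are within sqrt (Z G) of f 0, so (f x - f y)^2 <= 4 Z G; doubling gives 8 Z, and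
   averaging over y gives 2 / Z. *)
have H : Z * f x ^+ 2 <= 2 * F + Z * (8 * Z * G).
  rewrite -!Rintegral_itv_cst -RintegralZl//; last by case: sf.
  rewrite -RintegralD; [|by []|by apply: integZ => //; case: sf|exact: integ_cst0Z].
  apply: le_Rintegral => //; first exact: integ_cst0Z.
    by apply: integD => //; [apply: integZ => //; case: sf|exact: integ_cst0Z].
  move=> y; rewrite /= in_itv/= => y0Z.
  have hx := primitive_on_dist_sqr fg sg x0Z.
  have hy := primitive_on_dist_sqr fg sg y0Z.
  rewrite -/G in hx hy.
  have := sqr_ge0 ((f x - f 0) + (f y - f 0)).
  have := sqr_ge0 (f x - 2 * f y).
  nra.
rewrite -(ler_pM2l hZ).
apply: le_trans H _.
rewrite (_ : Z * ((2 / Z + 8 * Z) * _) = (2 + 8 * Z ^+ 2) * (F + G)); last first.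
  by field; rewrite gt_eqF.
by have := sqr_ge0 Z; nra.
Qed.

End Primitive.

(** * The vector space of triples (u, u', u'') *)

HB.instance Definition _ (R : realType) := gen_eqMixin (H2f R).
HB.instance Definition _ (R : realType) := gen_choiceMixin (H2f R).

Section H2lmod.
Context {R : realType}.
Implicit Types u v w : H2f R.

Definition H2zero := MkH2f (fun=> 0 : R) (fun=> 0) (fun=> 0).
Definition H2opp u := MkH2f (fun x => - fv u x) (fun x => - fd1 u x) (fun x => - fd2 u x).
Definition H2scale (t : R) u :=
  MkH2f (fun x => t * fv u x) (fun x => t * fd1 u x) (fun x => t * fd2 u x).

Lemma H2f_eq u v :
  fv u =1 fv v -> fd1 u =1 fd1 v -> fd2 u =1 fd2 v -> u = v.
Proof. by case: u v => [a b c] [a' b' c'] /= /funext-> /funext-> /funext->. Qed.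

Lemma H2addA : associative (@H2add R).
Proof. by move=> u v w; apply: H2f_eq => x /=; rewrite addrA. Qed.
Lemma H2addC : commutative (@H2add R).
Proof. by move=> u v; apply: H2f_eq => x /=; rewrite addrC. Qed.
Lemma H2add0 : left_id H2zero (@H2add R).
Proof. by move=> u; apply: H2f_eq => x /=; rewrite add0r. Qed.
Lemma H2addN : left_inverse H2zero H2opp (@H2add R).
Proof. by move=> u; apply: H2f_eq => x /=; rewrite addNr. Qed.

HB.instance Definition _ := GRing.isZmodule.Build (H2f R) H2addA H2addC H2add0 H2addN.

Lemma H2scaleA a b u : H2scale a (H2scale b u) = H2scale (a * b) u.
Proof. by apply: H2f_eq => x /=; rewrite mulrA. Qed.
Lemma H2scale1 : left_id 1 H2scale.
Proof. by move=> u; apply: H2f_eq => x /=; rewrite mul1r. Qed.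
Lemma H2scaleDr : right_distributive H2scale +%R.
Proof. by move=> a u v; apply: H2f_eq => x /=; rewrite mulrDr. Qed.
Lemma H2scaleDl u : {morph H2scale^~ u : a b / a + b}.
Proof. by move=> a b; apply: H2f_eq => x /=; rewrite mulrDl. Qed.

HB.instance Definition _ :=
  GRing.Zmodule_isLmodule.Build R (H2f R) H2scaleA H2scale1 H2scaleDr H2scaleDl.

Lemma PsubE (a b : Pair) : Psub a b = a - b :> H2f R * H2f R.
Proof. by []. Qed.

End H2lmod.

(** * The Hilbert space H^2(0, Z) *)

Section H2Hilbert.
Context {R : realType}.
Notation mu := (@lebesgue_measure R).
Context (Z : R) (hZ : 0 < Z).
Implicit Types u v w : H2f R.

Notation D := `[0, Z]%classic.
Notation l2 := (l2dot mu D).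

Lemma isH2P u : isH2 Z u <->
  [/\ sq_integ mu D (fd2 u), primitive_on Z (fd1 u) (fd2 u)
    & primitive_on Z (fv u) (fd1 u)].
Proof.
split=> [[m2 [i2 p]]|[[m2 i2] p1 p0]].
  by split=> // x /p[].
by split=> //; split=> // x x0Z; split; [exact: p1|exact: p0].
Qed.

Section Regularity.
Context u (hu : isH2 Z u).

Lemma isH2_primitive1 : primitive_on Z (fd1 u) (fd2 u).
Proof. by case/isH2P: hu. Qed.

Lemma isH2_primitive0 : primitive_on Z (fv u) (fd1 u).
Proof. by case/isH2P: hu. Qed.

Lemma isH2_sq_integ2 : sq_integ mu D (fd2 u).
Proof. by case/isH2P: hu. Qed.

Lemma isH2_bd_meas1 : bd_meas D (fd1 u).
Proof.
apply: (primitive_on_bd_meas hZ isH2_primitive1).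
exact/(sq_integ_integ0Z hZ)/isH2_sq_integ2.
Qed.

Lemma isH2_sq_integ1 : sq_integ mu D (fd1 u).
Proof. exact/(bd_meas_sq_integ0Z hZ)/isH2_bd_meas1. Qed.

Lemma isH2_sq_integ0 : sq_integ mu D (fv u).
Proof.
apply: (bd_meas_sq_integ0Z hZ).
apply: (primitive_on_bd_meas hZ isH2_primitive0).
exact/(sq_integ_integ0Z hZ)/isH2_sq_integ1.
Qed.

End Regularity.

Lemma isH2_submodule : submodule (isH2 Z : set (H2f R)).
Proof.
split=> [|t u v hu hv].
  apply/isH2P; split=> [|x _|x _].
  - exact: (bd_meas_sq_integ0Z hZ (bd_meas_cst D 0)).
  - by rewrite /Rintegral integral0 /= addr0.
  - by rewrite /Rintegral integral0 /= addr0.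
apply/isH2P; split.
- apply: sq_integD => //; last exact: isH2_sq_integ2.
  by apply: sq_integZ => //; exact: isH2_sq_integ2.
- apply: primitive_on_lin; [| |exact: isH2_primitive1|exact: isH2_primitive1].
  + exact/(sq_integ_integ0Z hZ)/isH2_sq_integ2.
  + exact/(sq_integ_integ0Z hZ)/isH2_sq_integ2.
- apply: primitive_on_lin; [| |exact: isH2_primitive0|exact: isH2_primitive0].
  + exact/(sq_integ_integ0Z hZ)/isH2_sq_integ1.
  + exact/(sq_integ_integ0Z hZ)/isH2_sq_integ1.
Qed.

Lemma H2dotE u v : isH2 Z u -> isH2 Z v ->
  H2dot Z u v = l2 (fv u) (fv v) + l2 (fd1 u) (fd1 v) + l2 (fd2 u) (fd2 v).
Proof.
move=> hu hv; rewrite /l2dot.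
have i0 : integ mu D (fun x => fv u x * fv v x).
  by apply: sq_integM => //; exact: isH2_sq_integ0.
have i1 : integ mu D (fun x => fd1 u x * fd1 v x).
  by apply: sq_integM => //; exact: isH2_sq_integ1.
have i2 : integ mu D (fun x => fd2 u x * fd2 v x).
  by apply: sq_integM => //; exact: isH2_sq_integ2.
by rewrite -RintegralD// -RintegralD//; exact: integD.
Qed.

Lemma H2_semi_inner : semi_inner (isH2 Z : set (H2f R)) (H2dot Z).
Proof.
have sm := isH2_submodule.
have [_ lC lL l0] := l2_semi_inner mu (measurable_itv `[0, Z]).
split=> //.
- move=> u v; apply: eq_Rintegral => x _.
  by rewrite [fv u x * _]mulrC [fd1 u x * _]mulrC [fd2 u x * _]mulrC.
- move=> t u v w hu hv hw.
  rewrite !H2dotE//; last exact: (sm.2).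
  rewrite -[fv (t *: u + v)]/(t *: fv u + fv v).
  rewrite -[fd1 (t *: u + v)]/(t *: fd1 u + fd1 v).
  rewrite -[fd2 (t *: u + v)]/(t *: fd2 u + fd2 v).
  rewrite (lL _ _ _ _ (isH2_sq_integ0 hu) (isH2_sq_integ0 hv) (isH2_sq_integ0 hw)).
  rewrite (lL _ _ _ _ (isH2_sq_integ1 hu) (isH2_sq_integ1 hv) (isH2_sq_integ1 hw)).
  rewrite (lL _ _ _ _ (isH2_sq_integ2 hu) (isH2_sq_integ2 hv) (isH2_sq_integ2 hw)).
  by ring.
- by move=> u _; apply: Rintegral_ge0 => x _; rewrite -!expr2 !addr_ge0 ?sqr_ge0.
Qed.

Lemma l2_sqr f : l2 f f = \int[mu]_(x in D) f x ^+ 2.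
Proof. by apply: eq_Rintegral => x _; rewrite expr2. Qed.

Lemma l2_ge0 f : 0 <= l2 f f.
Proof. by apply: Rintegral_ge0 => x _; rewrite -expr2 sqr_ge0. Qed.

Definition sobolev_cst := 2 / Z + 8 * Z.

Lemma sobolev_cst_gt0 : 0 < sobolev_cst.
Proof. by rewrite addr_gt0 ?divr_gt0 ?mulr_gt0. Qed.

Lemma sobolev0 u x : isH2 Z u -> 0 <= x <= Z ->
  fv u x ^+ 2 <= sobolev_cst * H2dot Z u u.
Proof.
move=> hu x0Z.
have := primitive_on_sobolev hZ (isH2_primitive0 hu) (isH2_sq_integ1 hu) x0Z.
move/le_trans; apply; rewrite ler_wpM2l ?(ltW sobolev_cst_gt0)//.
by rewrite H2dotE// !l2_sqr -addrA lerD2l lerDl -l2_sqr l2_ge0.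
Qed.

Lemma sobolev1 u x : isH2 Z u -> 0 <= x <= Z ->
  fd1 u x ^+ 2 <= sobolev_cst * H2dot Z u u.
Proof.
move=> hu x0Z.
have := primitive_on_sobolev hZ (isH2_primitive1 hu) (isH2_sq_integ2 hu) x0Z.
move/le_trans; apply; rewrite ler_wpM2l ?(ltW sobolev_cst_gt0)//.
by rewrite H2dotE// !l2_sqr -addrA lerDr -l2_sqr l2_ge0.
Qed.

(** With c = 2 Z + 2 Z^2, the integral of u'^2 is at most c (u'(0)^2 + int u''^2), and that of u^2
    costs a further factor 2 Z^2; the terms 1 and 2 Z account for u'' itself and for u(0)^2. *)
Definition poincare_cst := 1 + 2 * Z + (1 + 2 * Z ^+ 2) * (2 * Z + 2 * Z ^+ 2).

Lemma poincare_cst_gt0 : 0 < poincare_cst.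
Proof.
by rewrite /poincare_cst; have := hZ; have := sqr_ge0 Z; nra.
Qed.

(** Integrate twice from 0. H^2 convergence is thus reduced to that of u(0), u'(0) and u'', and on
    H_0 the second derivatives control the whole norm. *)
Lemma H2dot_le u : isH2 Z u ->
  H2dot Z u u <= poincare_cst *
    (fv u 0 ^+ 2 + fd1 u 0 ^+ 2 + \int[mu]_(x in D) fd2 u x ^+ 2).
Proof.
move=> hu; rewrite H2dotE// !l2_sqr.
have h1 := int_primitive_on_sqr_le hZ (isH2_primitive1 hu) (isH2_sq_integ2 hu).
have h0 := int_primitive_on_sqr_le hZ (isH2_primitive0 hu) (isH2_sq_integ1 hu).
have s0 : 0 <= \int[mu]_(x in D) fd2 u x ^+ 2 by rewrite -l2_sqr l2_ge0.
move: h1 h0 s0 (sqr_ge0 (fv u 0)) (sqr_ge0 (fd1 u 0)).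
set A := \int[mu]_(x in D) fd1 u x ^+ 2; set B := \int[mu]_(x in D) fv u x ^+ 2.
set S := \int[mu]_(x in D) _; set a := fv u 0 ^+ 2; set b := fd1 u 0 ^+ 2.
move=> h1 h0 s0 a0 b0; rewrite /poincare_cst.
set c := 2 * Z + 2 * Z ^+ 2.
have Z2 := sqr_ge0 Z.
have c0 : 0 <= c by rewrite /c addr_ge0 ?mulr_ge0// ltW.
have h1' : A <= c * (b + S).
  apply: le_trans h1 _; rewrite /c -subr_ge0.
  rewrite (_ : _ - _ = 2 * (Z ^+ 2 * b + Z * S)); last by ring.
  by rewrite mulr_ge0// addr_ge0// mulr_ge0// ltW.
have h0' : B <= 2 * Z * a + 2 * Z ^+ 2 * (c * (b + S)).
  apply: le_trans h0 _; rewrite -subr_ge0.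
  rewrite (_ : _ - _ = 2 * Z ^+ 2 * (c * (b + S) - A)); last by ring.
  by apply: mulr_ge0; [exact: mulr_ge0|rewrite subr_ge0].
have e1 : 0 <= c * a by rewrite mulr_ge0.
have e2 : 0 <= Z ^+ 2 * (c * a) by rewrite mulr_ge0.
have e3 : 0 <= Z * (b + S) by rewrite mulr_ge0 ?addr_ge0// ltW.
rewrite -subr_ge0 (_ : _ - _ =
  (2 * Z * a + 2 * Z ^+ 2 * (c * (b + S)) - B) + (c * (b + S) - A) +
  (a + b + 2 * (Z * (b + S)) + c * a + 2 * (Z ^+ 2 * (c * a)))); last by ring.
have sum_ge0 (p q r s t w y : R) : 0 <= p -> 0 <= q -> 0 <= r -> 0 <= s ->
  0 <= t -> 0 <= w -> 0 <= y -> 0 <= p + q + (r + s + 2 * t + w + 2 * y) by lra.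
by apply: sum_ge0 => //; rewrite subr_ge0.
Qed.

Lemma H2dot_ge_fd2 u : isH2 Z u -> \int[mu]_(x in D) fd2 u x ^+ 2 <= H2dot Z u u.
Proof. by move=> hu; rewrite H2dotE// -l2_sqr lerDr addr_ge0// l2_ge0. Qed.

(** Passes from the squared rate 8^-n of [seq_complete] to the rate 2^-n of [dist_geometric_cauchy],
    as 8^-n <= 4^-n. *)
Lemma sqrt_mul_geometric (c a z : R) n : 0 <= c -> z ^+ 2 <= c * a -> a <= 8^-1 ^+ n ->
  `|z| <= Num.sqrt c * 2^-1 ^+ n.
Proof.
move=> c0 za an.
rewrite -ler_sqr ?nnegrE ?mulr_ge0 ?sqrtr_ge0 ?exprn_ge0 ?invr_ge0//.
rewrite real_normK ?num_real// exprMn sqr_sqrtr// -exprM mulnC exprM.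
rewrite (le_trans za)// ler_wpM2l// (le_trans an)//.
apply: lerXn2r; rewrite ?nnegrE ?exprn_ge0 ?invr_ge0//.
rewrite (_ : 2^-1 ^+ 2 = 2 * 8^-1 :> R); last by field.
by rewrite ler_peMl ?invr_ge0// ler1n.
Qed.

(** The second derivatives converge in L^2 and, by Sobolev, the values u(0) and u'(0) converge;
    integrating the limit of the former twice from the limits of the latter gives an element of H^2
    by construction. *)
Lemma H2_complete : seq_complete (H2dot Z) (isH2 Z : set (H2f R)).
Proof.
move=> x hx dx; have sm := isH2_submodule.
have hd n : isH2 Z (x n.+1 - x n) by exact: (submoduleB sm).
have [f sf fx] := @l2_complete _ _ _ mu D (measurable_itv _) (fun n => fd2 (x n))
  (fun n => isH2_sq_integ2 (hx n)) (fun n => le_trans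
    (eq_ind_r (fun z => z <= _) (H2dot_ge_fd2 (hd n)) (l2_sqr _)) (dx n)).
have c0 := ltW sobolev_cst_gt0.
have Z00 : 0 <= (0 : R) <= Z by rewrite lexx ltW.
have [l1 [l1c _]] := @dist_geometric_cauchy _ (fun n => fd1 (x n) 0) _ (sqrtr_ge0 _)
  (fun n => sqrt_mul_geometric c0 (sobolev1 (hd n) Z00) (dx n)).
have [l0 [l0c _]] := @dist_geometric_cauchy _ (fun n => fv (x n) 0) _ (sqrtr_ge0 _)
  (fun n => sqrt_mul_geometric c0 (sobolev0 (hd n) Z00) (dx n)).
pose y1 s := l1 + \int[mu]_(t in `[0, s]) f t.
pose y0 s := l0 + \int[mu]_(t in `[0, s]) y1 t.
have y10 : y1 0 = l1 by rewrite /y1 set_itv1 Rintegral_set1 addr0.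
have y00 : y0 0 = l0 by rewrite /y0 set_itv1 Rintegral_set1 addr0.
pose y := MkH2f y0 y1 f.
have hy : isH2 Z y.
  by apply/isH2P; split=> // s _ /=; rewrite ?y10 ?y00.
exists y => // e e0.
have hyx n : isH2 Z (y - x n) by exact: (submoduleB sm).
pose e1 := e / (3 * poincare_cst).
have e10 : 0 < e1 by rewrite divr_gt0// mulr_gt0// poincare_cst_gt0.
have cvg_sqr (z : nat -> R) l : z @ \oo --> l ->
    exists N, forall n, (N <= n)%N -> (l - z n) ^+ 2 < e1.
  move=> zl; have s0 : 0 < Num.sqrt e1 by rewrite sqrtr_gt0.
  have /cvgrPdist_lt/(_ _ s0) [N _ HN] := zl.
  exists N => n Nn; have := HN n Nn; rewrite /= => h.
  rewrite -real_normK ?num_real// -[ltRHS]sqr_sqrtr ?ltW//.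
  by rewrite ltr_sqr ?nnegrE// sqrtr_ge0.
have [N0 HN0] := cvg_sqr _ _ l0c.
have [N1 HN1] := cvg_sqr _ _ l1c.
have [N2 HN2] := fx _ e10.
exists (maxn N0 (maxn N1 N2)) => n; rewrite !geq_max => /and3P[h0 h1 h2].
apply: le_lt_trans (H2dot_le (hyx n)) _.
rewrite (_ : e = poincare_cst * (e1 + e1 + e1)); last first.
  by rewrite /e1; field; rewrite gt_eqF// poincare_cst_gt0.
rewrite ltr_pM2l ?poincare_cst_gt0//.
apply: ltrD; first apply: ltrD.
- by have := HN0 _ h0; rewrite -y00.
- by have := HN1 _ h1; rewrite -y10.
- by have := HN2 _ h2; rewrite l2_sqr.
Qed.

Definition isH2P2 : set (H2f R * H2f R) := [set a | isH2 Z a.1 /\ isH2 Z a.2].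

Lemma Pdot_semi_inner : semi_inner isH2P2 (Pdot Z).
Proof.
have [sm dC dL d0] := H2_semi_inner.
split.
- split; first by split; exact: (sm.1).
  by move=> t u v [u1 u2] [v1 v2]; split; exact: (sm.2).
- by move=> u v; rewrite /Pdot dC [X in _ + X]dC.
- move=> t u v w [u1 u2] [v1 v2] [w1 w2].
  by rewrite /Pdot /= !dL//; ring.
- by move=> u [u1 u2]; rewrite addr_ge0// d0.
Qed.

Lemma Pdot_ge0 a : isH2P2 a -> 0 <= Pdot Z a a.
Proof. by have [_ _ _] := Pdot_semi_inner; apply. Qed.

Lemma le_H2dot_Pdot a : isH2P2 a ->
  H2dot Z a.1 a.1 <= Pdot Z a a /\ H2dot Z a.2 a.2 <= Pdot Z a a.
Proof.
have [_ _ _ d0] := H2_semi_inner.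
by move=> [a1 a2]; rewrite /Pdot lerDl lerDr !d0.
Qed.

Lemma P_complete : seq_complete (Pdot Z) isH2P2.
Proof.
move=> x hx dx; have [sm _] := Pdot_semi_inner.
have hd n : isH2P2 (x n.+1 - x n) by exact: (submoduleB sm).
have [n|n|u hu ux] := @H2_complete (fun n => (x n).1).
- by case: (hx n).
- exact: le_trans (le_H2dot_Pdot (hd n)).1 (dx n).
have [n|n|v hv vx] := @H2_complete (fun n => (x n).2).
- by case: (hx n).
- exact: le_trans (le_H2dot_Pdot (hd n)).2 (dx n).
exists (u, v) => // e e0.
have e20 : 0 < e / 2 by rewrite divr_gt0.
have [N HN] := ux _ e20; have [M HM] := vx _ e20.
exists (maxn N M) => n; rewrite geq_max => /andP[Nn Mn].
by rewrite [ltRHS](splitr e); apply: ltrD; [exact: HN|exact: HM].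
Qed.

Lemma inH0_isH2P2 h : inH0 Z h -> isH2P2 h.
Proof. by case=> h1 [h2 _]; split. Qed.

Lemma inH0_submodule : submodule (inH0 Z : set (H2f R * H2f R)).
Proof.
have [[s0 sL] _ _ _] := Pdot_semi_inner.
split.
  by have [h1 h2] := s0; do 2 split=> //.
move=> t u v hu hv; have := sL t _ _ (inH0_isH2P2 hu) (inH0_isH2P2 hv).
case: hu hv => [_ [_ [a1 [a2 [a3 [a4 [a5 a6]]]]]]] [_ [_ [b1 [b2 [b3 [b4 [b5 b6]]]]]]].
case=> h1 h2; do 2 (split=> //).
rewrite /= a1 a2 a3 a4 a5 a6 b1 b2 b3 b4 b5 b6 mulr0 addr0.
by [].
Qed.

Lemma eq0_of_sqr_le_small (z c : R) :  0 < c ->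
  (forall e, 0 < e -> exists2 a, a < e & z ^+ 2 <= c * a) -> z = 0.
Proof.
move=> c0 H; apply/eqP; rewrite -sqrf_eq0 eq_le sqr_ge0 andbT.
apply/ler_addgt0Pr => e e0; rewrite add0r.
have [a ae za] := H (e / c) (divr_gt0 e0 c0).
by rewrite (le_trans za)// mulrC -ler_pdivlMr// ltW.
Qed.

(** Point values of u and u' are continuous for the H^2 norm by Sobolev, so a boundary value shared
    by all terms passes to the limit. This closes H_0 and the boundary conditions of the ball. *)
Lemma limit_point_value (x : nat -> H2f R * H2f R) (y : H2f R * H2f R) :
  isH2P2 y -> (forall n, isH2P2 (x n)) ->
  (forall e, 0 < e -> exists N, forall n, (N <= n)%N -> Pdot Z (y - x n) (y - x n) < e) ->
  forall s, 0 <= s <= Z -> forall c,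
  [/\ (forall n, fv (x n).1 s = c) -> fv y.1 s = c,
      (forall n, fd1 (x n).1 s = c) -> fd1 y.1 s = c,
      (forall n, fv (x n).2 s = c) -> fv y.2 s = c &
      (forall n, fd1 (x n).2 s = c) -> fd1 y.2 s = c].
Proof.
move=> hy hx yx s s0Z c.
have sm : submodule isH2P2 by case: Pdot_semi_inner.
have hd n : isH2P2 (y - x n) by exact: (submoduleB sm).
split=> xc; apply/eqP; rewrite -subr_eq0; apply/eqP;
  apply: (eq0_of_sqr_le_small sobolev_cst_gt0) => e e0;
  have [N /(_ N (leqnn N)) HN] := yx _ e0;
  exists (Pdot Z (y - x N) (y - x N)) => //;
  have [d1 d2] := le_H2dot_Pdot (hd N); have [h1 h2] := hd N; rewrite -(xc N).
- apply: le_trans (ler_wpM2l (ltW sobolev_cst_gt0) d1); exact: sobolev0 h1 s0Z.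
- apply: le_trans (ler_wpM2l (ltW sobolev_cst_gt0) d1); exact: sobolev1 h1 s0Z.
- apply: le_trans (ler_wpM2l (ltW sobolev_cst_gt0) d2); exact: sobolev0 h2 s0Z.
- apply: le_trans (ler_wpM2l (ltW sobolev_cst_gt0) d2); exact: sobolev1 h2 s0Z.
Qed.

Lemma inH0_complete : seq_complete (Pdot Z) (inH0 Z : set (H2f R * H2f R)).
Proof.
move=> x hx dx; have hx2 n := inH0_isH2P2 (hx n).
have [y hy yx] := P_complete hx2 dx; exists y => //.
have Z00 : 0 <= (0 : R) <= Z by rewrite lexx ltW.
have ZZ : 0 <= Z <= Z by rewrite lexx ltW.
have [p1 p2 p3 p4] := limit_point_value hy hx2 yx Z00 0.
have [_ q2 _ q4] := limit_point_value hy hx2 yx ZZ 0.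
case: hy => y1 y2.
by refine (conj y1 (conj y2 (conj (p1 _) (conj (p2 _) (conj (q2 _)
  (conj (p3 _) (conj (p4 _) (q4 _)))))))) => n;
  case: (hx n) => [_ [_ [? [? [? [? []]]]]]].
Qed.

End H2Hilbert.

(** * Carleman estimate *)

Section Carleman.
Context {R : realType}.
Notation mu := (@lebesgue_measure R).
Implicit Types (f g : R -> R) (a lam x Z : R).

Lemma continuous_expRM a : continuous (fun x : R => expR (a * x)).
Proof.
move=> x; apply: continuous_comp; last exact: continuous_expR.
exact: mulrl_continuous.
Qed.

Lemma bd_meas_expRM a Z : bd_meas `[0, Z] (fun x => expR (a * x)).
Proof.
split.
  apply: measurable_funTS; apply: continuous_measurable_fun.
  exact: continuous_expRM.
exists (expR (`|a| * Z)) => x; rewrite /= in_itv/= => /andP[x0 xZ].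
rewrite ger0_norm ?expR_ge0// ler_expR.
apply: (@le_trans _ _ (`|a| * x)).
  by rewrite ler_wpM2r// ler_norm.
by rewrite ler_wpM2l.
Qed.

Lemma Rintegral_expRM a x : 0 < a -> 0 < x ->
  \int[mu]_(t in `[0, x]) expR (a * t) = (expR (a * x) - 1) / a.
Proof.
move=> a0 x0; have an0 : a != 0 by rewrite gt_eqF.
have dF (t : R) : is_derive t 1 (fun s => a^-1 * expR (a * s)) (expR (a * t)).
  by apply: is_derive_eq; rewrite /GRing.scale/=; field.
have cF : continuous (fun s => a^-1 * expR (a * s)).
  by move=> t; apply: cvgM; [exact: cvg_cst|exact: continuous_expRM].
rewrite /Rintegral (@continuous_FTC2 _ _ (fun s => a^-1 * expR (a * s)))//.
- by rewrite mulr0 expR0 mulr1 mulrBl mul1r mulrC.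
- apply: continuous_subspaceT; exact: continuous_expRM.
- split.
  + by move=> t _; have [] := dF t.
  + by apply: cvg_at_right_filter; exact: cF.
  + by apply: cvg_at_left_filter; exact: cF.
- by move=> t _; rewrite derive1E; have [_ ->] := dF t.
Qed.

(** Split g as (g exp(-lam t)) exp(lam t). Cauchy-Schwarz on [0, x] leaves the factor (exp(2 lam x)
    - 1) / (2 lam), whose exponential the weight at x cancels. *)
Lemma carleman Z lam f g x : 0 < Z -> 0 < lam -> primitive_on Z f g ->
  sq_integ mu `[0, Z] g -> f 0 = 0 -> 0 <= x <= Z ->
  f x ^+ 2 * expR (- (2 * lam * x)) <=
  (\int[mu]_(t in `[0, Z]) (g t ^+ 2 * expR (- (2 * lam * t)))) / (2 * lam).
Proof.
move=> Z0 lam0 fg sg f0 x0Z.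
have l20 : 0 < 2 * lam by rewrite mulr_gt0.
have wE t : expR (- (2 * lam * t)) = expR (- lam * t) ^+ 2.
  by rewrite -expRM_natl; congr expR; ring.
have iD : integ mu `[0, Z] (fun t => g t ^+ 2 * expR (- (2 * lam * t))).
  have : sq_integ mu `[0, Z] (fun t => expR (- lam * t) * g t).
    by apply: bd_measM_sq_integ => //; exact: bd_meas_expRM.
  move=> [_]; congr (integ _ _ _); apply/funext => t.
  by rewrite exprMn mulrC wE.
have g0 t : 0 <= g t ^+ 2 * expR (- (2 * lam * t)).
  by rewrite mulr_ge0 ?sqr_ge0 ?expR_ge0.
rewrite fg// f0 add0r.
have /andP[] := x0Z; rewrite le_eqVlt => /predU1P[<- _|x0 xZ].
  rewrite set_itv1 Rintegral_set1 expr0n mul0r divr_ge0 ?(ltW l20)//.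
  by apply: Rintegral_ge0.
have mx : measurable (`[0, x]%classic : set (measurableTypeR R)) by [].
have sgx : sq_integ mu `[0, x] g.
  case: sg => mg ig; split; last exact: integ_subitv x0Z ig.
  by apply: measurable_funS mg => //; exact: subitv0.
have s1 := bd_measM_sq_integ mx (bd_meas_expRM (- lam) x) sgx.
have s2 := bd_meas_sq_integ0Z x0 (bd_meas_expRM lam x).
have := sCauchySchwarz (l2_semi_inner mu mx) s1 s2.
rewrite /l2dot.
under eq_Rintegral do rewrite mulrAC -expRD mulNr addNr expR0 mul1r.
under [X in _ <= X * _]eq_Rintegral do rewrite -expr2 exprMn mulrC -wE.
under [X in _ <= _ * X]eq_Rintegral do rewrite -expRD -mulrDl -mulr2n -mulr_natl.
rewrite Rintegral_expRM// => cs.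
have h := le_Rintegral_subitv x0Z iD (fun t _ => g0 t).
set S := \int[mu]_(t in `[0, Z]) _ in h *.
set Sx := \int[mu]_(t in `[0, x]) (_ * expR _) in h cs.
have S0 : 0 <= Sx by apply: Rintegral_ge0.
have e0 := expR_gt0 (2 * lam * x).
have e1 : 1 <= expR (2 * lam * x).
  by rewrite -[leLHS]expR0 ler_expR; apply: mulr_ge0; exact: ltW.
have : Sx * ((expR (2 * lam * x) - 1) / (2 * lam)) <= S * (expR (2 * lam * x) / (2 * lam)).
  apply: ler_pM => //.
  - by apply: divr_ge0; [rewrite subr_ge0|exact: ltW].
  - by rewrite ler_pM2r ?invr_gt0// gerBl.
move=> /(le_trans cs) {}cs.
rewrite expRN ler_pdivrMr// (le_trans cs)// le_eqVlt; apply/orP; left; apply/eqP.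
by field; rewrite gt_eqF.
Qed.

End Carleman.

(** * Pointwise estimates of the Taylor remainder *)

Section Pointwise.
Context {R : realFieldType}.
Implicit Types x y u v w p s q r K M : R.

Lemma ler_norm_mul_bound x y K M : `|x| <= K -> `|y| <= M -> `|x * y| <= K * M.
Proof. by move=> xK yM; rewrite normrM ler_pM. Qed.

Lemma sqr_lin_le u v x y c : `|x| <= c -> `|y| <= c ->
  (u * x + v * y) ^+ 2 <= 2 * c ^+ 2 * (u ^+ 2 + v ^+ 2).
Proof.
move=> xc yc; have sqr_le z : `|z| <= c -> z ^+ 2 <= c ^+ 2.
  by move=> zc; rewrite -[leLHS]real_normK ?num_real// lerXn2r ?nnegrE// (le_trans _ zc).
have ux : (u * x) ^+ 2 <= u ^+ 2 * c ^+ 2.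
  by rewrite exprMn ler_wpM2l ?sqr_ge0// sqr_le.
have vy : (v * y) ^+ 2 <= v ^+ 2 * c ^+ 2.
  by rewrite exprMn ler_wpM2l ?sqr_ge0// sqr_le.
by have := sqr_ge0 (u * x - v * y); nra.
Qed.

Section Coefficients.
Context (al be ga de K M : R).
Hypotheses (alK : 0 <= al <= K) (beK : 0 <= be <= K) (gaK : 0 <= ga <= K)
  (deK : 0 <= de <= K).

(** [al], [be], [ga], [de] stand for 2k/eps, 1/eps^2, 2 sqrt k, 1/(eps sqrt k); p, s are the first
    derivatives of the base point and u, v those of the increment. [lin_cst] is the sum of the
    bounds on the terms multiplying u in [incr_part_le]. *)
Definition lin_cst := K * (11 * M + 2).
Definition nl_cst := K * (6 * M ^+ 2 + 3 * M).
(** The first term is four times the bound 2 [lin_cst]^2 on E^2; the second is 2 * 4 K from the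
    factor 2 Q, times the bound on L_1 + L_2 relative to 1 + q''^2 + r''^2. *)
Definition rem_cst := 8 * lin_cst ^+ 2 + 8 * K * (1 + 2 * nl_cst).

Let K0 : 0 <= K. Proof. by have /andP[h1 h2] := alK; exact: le_trans h2. Qed.

Let coefM x y m : 0 <= x <= K -> `|y| <= m -> `|x * y| <= K * m.
Proof. by move=> /andP[x0 xK] ym; apply: ler_norm_mul_bound => //; rewrite ger0_norm. Qed.

Lemma lin_part_le p s u v : `|p| <= M -> `|s| <= M ->
  (al * (u * (p - s) + p * (u - v)) + 2 * (p - s) * (u - v) * be
    - ga * u - (u - v) * de) ^+ 2
  <= 2 * lin_cst ^+ 2 * (u ^+ 2 + v ^+ 2).
Proof.
move=> pM sM; have M0 : 0 <= M := le_trans (normr_ge0 _) pM.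
have psM : `|p - s| <= 2 * M by rewrite (le_trans (ler_normB _ _))//; lra.
have h1 := coefM alK pM; have h2 := coefM alK psM; have h3 := coefM beK psM.
have h4 : `|ga * 1| <= K * 1 by apply: coefM => //; rewrite normr1.
have h5 : `|de * 1| <= K * 1 by apply: coefM => //; rewrite normr1.
have KM : 0 <= K * M by exact: mulr_ge0.
rewrite (_ : _ - _ - _ = u * (al * (p - s) + al * p + 2 * (be * (p - s)) - ga * 1 - de * 1)
  + v * (- (al * p) - 2 * (be * (p - s)) + de * 1)); last by ring.
move: h1 h2 h3 h4 h5; rewrite !ler_norml /lin_cst => /andP[? ?] /andP[? ?] /andP[? ?] /andP[? ?] /andP[? ?].
by apply: sqr_lin_le; rewrite ler_norml; apply/andP; split; lra.
Qed.

(** The quadratic part is absorbed by treating one factor [u - v] as a coefficient of size at most 2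
    M; the bounds on u and v serve this purpose. *)
Lemma incr_part_le p s u v :
  `|p| <= M -> `|s| <= M -> `|u| <= M -> `|v| <= M ->
  (al * (u * (p - s) + p * (u - v)) + 2 * (p - s) * (u - v) * be
    - ga * u - (u - v) * de + (al * u * (u - v) + (u - v) ^+ 2 * be)) ^+ 2
  <= 2 * lin_cst ^+ 2 * (u ^+ 2 + v ^+ 2).
Proof.
move=> pM sM uM vM; have M0 : 0 <= M := le_trans (normr_ge0 _) pM.
have psM : `|p - s| <= 2 * M by rewrite (le_trans (ler_normB _ _))//; lra.
have uvM : `|u - v| <= 2 * M by rewrite (le_trans (ler_normB _ _))//; lra.
have h1 := coefM alK pM; have h2 := coefM alK psM; have h3 := coefM beK psM.
have h4 : `|ga * 1| <= K * 1 by apply: coefM => //; rewrite normr1.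
have h5 : `|de * 1| <= K * 1 by apply: coefM => //; rewrite normr1.
have h6 := coefM alK uvM; have h7 := coefM beK uvM.
have KM : 0 <= K * M by exact: mulr_ge0.
rewrite (_ : _ - _ - _ + _ = u * (al * (p - s) + al * p + 2 * (be * (p - s)) - ga * 1 - de * 1
   + al * (u - v) + be * (u - v))
  + v * (- (al * p) - 2 * (be * (p - s)) + de * 1 - be * (u - v))); last by ring.
move: h1 h2 h3 h4 h5 h6 h7; rewrite !ler_norml /lin_cst.
move=> /andP[? ?] /andP[? ?] /andP[? ?] /andP[? ?] /andP[? ?] /andP[? ?] /andP[? ?].
by apply: sqr_lin_le; rewrite ler_norml; apply/andP; split; lra.
Qed.

Lemma quad_part_le u v :
  `|al * u * (u - v) + (u - v) ^+ 2 * be| <= 4 * K * (u ^+ 2 + v ^+ 2).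
Proof.
have h1 : `|u * (u - v)| <= 2 * (u ^+ 2 + v ^+ 2).
  have := sqr_ge0 (u - v); have := sqr_ge0 (u + v); have := sqr_ge0 u; have := sqr_ge0 v.
  by move=> ? ? ? ?; rewrite ler_norml; apply/andP; split; nra.
have h2 : `|(u - v) ^+ 2| <= 2 * (u ^+ 2 + v ^+ 2).
  rewrite ger0_norm ?sqr_ge0//; have := sqr_ge0 (u + v); nra.
have h3 := coefM alK h1; have h4 := coefM beK h2.
rewrite -mulrA [_ * be]mulrC (le_trans (ler_normD _ _))//; lra.
Qed.

Lemma nl_part_le p s : `|p| <= M -> `|s| <= M ->
  `|al * p * (p - s) + (p - s) ^+ 2 * be - ga * p - (p - s) * de| <= nl_cst.
Proof.
move=> pM sM; have M0 : 0 <= M := le_trans (normr_ge0 _) pM.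
have psM : `|p - s| <= 2 * M by rewrite (le_trans (ler_normB _ _))//; lra.
have h1 := coefM alK (ler_norm_mul_bound pM psM).
have h2 := coefM beK (ler_norm_mul_bound psM psM).
have h3 := coefM gaK pM; have h4 := coefM deK psM.
rewrite /nl_cst; move: h1 h2 h3 h4; rewrite !ler_norml.
by move=> /andP[? ?] /andP[? ?] /andP[? ?] /andP[? ?]; apply/andP; split; nra.
Qed.

Lemma rem_cst_ge0 : 0 <= M -> 0 <= rem_cst.
Proof.
move=> M0; have n0 : 0 <= nl_cst.
  by rewrite /nl_cst mulr_ge0// addr_ge0// mulr_ge0// sqr_ge0.
apply: addr_ge0; first by rewrite mulr_ge0 ?sqr_ge0.
by apply: mulr_ge0; [exact: mulr_ge0|apply: addr_ge0 => //; exact: mulr_ge0].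
Qed.

(* [q], [r], [x], [y] stand for second derivatives, the first two of the base
   point and the last two of the increment. *)
Lemma remainder_bounds q r N Q E x y w :
  0 <= M -> 0 <= w -> `|N| <= nl_cst -> `|Q| <= 4 * K * w ->
  E ^+ 2 <= 2 * lin_cst ^+ 2 * w ->
  let T := 2 * ((q + N) + (r + N)) * Q + (x + E) ^+ 2 + (y + E) ^+ 2 in
  let e := rem_cst * (1 + q ^+ 2 + r ^+ 2) * w in
  (x ^+ 2 + y ^+ 2) / 2 - e <= T /\ `|T| <= 2 * (x ^+ 2 + y ^+ 2) + e.
Proof.
move=> M0 w0 NM QK Ew /=.
set c := 2 * lin_cst ^+ 2 in Ew.
have n0 : 0 <= nl_cst := le_trans (normr_ge0 _) NM.
set g := 1 + q ^+ 2 + r ^+ 2.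
have q2 := sqr_ge0 q; have r2 := sqr_ge0 r.
have g1 : 1 <= g by rewrite /g; lra.
(* |q| <= (1 + q^2) / 2 trades the unbounded factor for the integrable density g. *)
have hq : `|q + N + (r + N)| <= g * (1 + 2 * nl_cst).
  have := sqr_ge0 (q - 1); have := sqr_ge0 (q + 1).
  have := sqr_ge0 (r - 1); have := sqr_ge0 (r + 1).
  move: NM; rewrite !ler_norml => /andP[N1 N2] ? ? ? ?.
  have h : 0 <= (g - 1) * nl_cst by rewrite mulr_ge0// subr_ge0.
  by apply/andP; split; rewrite /g in h *; nra.
have hT : `|2 * (q + N + (r + N)) * Q| <= 8 * K * (1 + 2 * nl_cst) * g * w.
  rewrite -mulrA normrM [`|2|]ger0_norm//.
  have := ler_norm_mul_bound hq QK; lra.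
have c0 : 0 <= c by rewrite mulr_ge0// sqr_ge0.
have hE : 4 * E ^+ 2 <= 4 * c * g * w.
  have cw : c * w <= c * w * g by rewrite ler_peMr// mulr_ge0.
  lra.
have -> : rem_cst * g * w = 4 * c * g * w + 8 * K * (1 + 2 * nl_cst) * g * w.
  by rewrite /rem_cst /c; ring.
have E2 := sqr_ge0 E.
(* These two squares give (x + E)^2 >= x^2 / 2 - E^2 and the same for y; the next two give (x + E)^2
   <= 2 x^2 + 2 E^2. *)
have s1 := sqr_ge0 (x + 2 * E); have s2 := sqr_ge0 (y + 2 * E).
have s3 := sqr_ge0 (x - E); have s4 := sqr_ge0 (y - E).
have s5 := sqr_ge0 (x + E); have s6 := sqr_ge0 (y + E).
have s7 := sqr_ge0 x; have s8 := sqr_ge0 y.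
move: hT; rewrite !ler_norml => /andP[t1 t2].
set T := 2 * (q + N + (r + N)) * Q in t1 t2 *.
set F := 8 * K * (1 + 2 * nl_cst) * g * w in t1 t2 *.
set G := 4 * c * g * w in hE *.
clearbody T F G.
by split; [nra|apply/andP; split; nra].
Qed.

End Coefficients.

End Pointwise.

(** * The functional J *)

Section Functional.
Context {R : realType}.
Notation mu := (@lebesgue_measure R).
Context (Z eps k : R) (hZ : 0 < Z).
Implicit Types (a h : H2f R * H2f R) (lam z : R).

Notation D := `[0, Z]%classic.

Let mD : measurable (D : set (measurableTypeR R)). Proof. by []. Qed.

(** The part of the increment of [Lnl] linear in [h], written in the exact shape of [lin_part_le] so
    that the pointwise bounds apply without rewriting; [qLnl] is the quadratic part. *)
Definition dLnl a h z :=
  2 * k / eps * (fd1 h.1 z * (fd1 a.1 z - fd1 a.2 z)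
                 + fd1 a.1 z * (fd1 h.1 z - fd1 h.2 z))
  + 2 * (fd1 a.1 z - fd1 a.2 z) * (fd1 h.1 z - fd1 h.2 z) * (eps ^+ 2)^-1
  - 2 * Num.sqrt k * fd1 h.1 z - (fd1 h.1 z - fd1 h.2 z) * (eps * Num.sqrt k)^-1.

Definition qLnl h z :=
  2 * k / eps * fd1 h.1 z * (fd1 h.1 z - fd1 h.2 z)
  + (fd1 h.1 z - fd1 h.2 z) ^+ 2 * (eps ^+ 2)^-1.

Definition J_integrand lam a z :=
  (L1 eps k a z ^+ 2 + L2 eps k a z ^+ 2) * expR (- (2 * lam * z)).

Definition dJ_integrand lam a h z :=
  (2 * L1 eps k a z * (fd2 h.1 z + dLnl a h z)
   + 2 * L2 eps k a z * (fd2 h.2 z + dLnl a h z)) * expR (- (2 * lam * z)).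

Definition dJ lam a h := \int[mu]_(z in D) dJ_integrand lam a h z.

(** With E = [dLnl] + [qLnl], each L_i contributes (L + x + E)^2 - L^2 - 2 L (x + [dLnl]) = 2 L
    [qLnl] + (x + E)^2, where x is u'' or v''. *)
Definition remJ a h z :=
  2 * ((fd2 a.1 z + Lnl eps k a z) + (fd2 a.2 z + Lnl eps k a z)) * qLnl h z
  + (fd2 h.1 z + (dLnl a h z + qLnl h z)) ^+ 2
  + (fd2 h.2 z + (dLnl a h z + qLnl h z)) ^+ 2.

Definition wgt lam (f : R -> R) :=
  \int[mu]_(z in D) (f z ^+ 2 * expR (- (2 * lam * z))).

Lemma LnlD a h z : Lnl eps k (a + h) z = Lnl eps k a z + dLnl a h z + qLnl h z.
Proof. by rewrite /Lnl /dLnl /qLnl /=; ring. Qed.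

Lemma J_integrandD lam a h z :
  J_integrand lam (a + h) z - J_integrand lam a z - dJ_integrand lam a h z =
  remJ a h z * expR (- (2 * lam * z)).
Proof.
rewrite /J_integrand /dJ_integrand /remJ /L1 /L2 LnlD /=.
by ring.
Qed.

Lemma dJ_integrand_lin lam a t h h' z :
  dJ_integrand lam a (t *: h + h') z =
  t * dJ_integrand lam a h z + dJ_integrand lam a h' z.
Proof. by rewrite /dJ_integrand /dLnl /=; ring. Qed.

Lemma bd_meas_wgt lam : bd_meas D (fun z => expR (- (2 * lam * z))).
Proof.
have := @bd_meas_expRM R (- (2 * lam)) Z.
by congr bd_meas; apply/funext => z; rewrite mulNr.
Qed.

Lemma integ_mul_wgt lam f : integ mu D f ->
  integ mu D (fun z => f z * expR (- (2 * lam * z))).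
Proof.
move=> fi; have := bd_measM_integ mD (bd_meas_wgt lam) fi.
by congr integ; apply/funext => z; rewrite mulrC.
Qed.

Lemma wgt_le1 lam z : 0 < lam -> D z -> expR (- (2 * lam * z)) <= 1.
Proof.
rewrite /= in_itv/= => lam0 /andP[z0 _].
by rewrite -[leRHS]expR0 ler_expR oppr_le0 !mulr_ge0// ltW.
Qed.

Lemma integ_wgt lam f : sq_integ mu D f ->
  integ mu D (fun z => f z ^+ 2 * expR (- (2 * lam * z))).
Proof.
by move=> [_ f2]; exact: integ_mul_wgt.
Qed.

Ltac bdm := repeat first [assumption | exact: bd_meas_cst | exact: bd_measX
  | apply: bd_measB | apply: bd_measD | apply: bd_measM | apply: bd_measX ].

Lemma bd_meas_Lnl a : isH2P2 Z a -> bd_meas D (Lnl eps k a).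
Proof.
move=> [h1 h2]; have b1 := isH2_bd_meas1 hZ h1; have b2 := isH2_bd_meas1 hZ h2.
by rewrite /Lnl /=; bdm.
Qed.

Lemma bd_meas_dLnl a h : isH2P2 Z a -> isH2P2 Z h -> bd_meas D (dLnl a h).
Proof.
move=> [h1 h2] [h3 h4].
have b1 := isH2_bd_meas1 hZ h1; have b2 := isH2_bd_meas1 hZ h2.
have b3 := isH2_bd_meas1 hZ h3; have b4 := isH2_bd_meas1 hZ h4.
by rewrite /dLnl /=; bdm.
Qed.

Lemma sq_integ_L a : isH2P2 Z a ->
  sq_integ mu D (L1 eps k a) /\ sq_integ mu D (L2 eps k a).
Proof.
move=> ha; have sN := bd_meas_sq_integ0Z hZ (bd_meas_Lnl ha).
by case: ha => h1 h2; split; apply: sq_integD => //; exact: isH2_sq_integ2.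
Qed.

Lemma integ_J lam a : isH2P2 Z a -> integ mu D (J_integrand lam a).
Proof.
move=> /sq_integ_L[[_ s1] [_ s2]].
by apply: integ_mul_wgt; exact: integD.
Qed.

Lemma sq_integ_dL a h : isH2P2 Z a -> isH2P2 Z h ->
  sq_integ mu D (fun z => fd2 h.1 z + dLnl a h z) /\
  sq_integ mu D (fun z => fd2 h.2 z + dLnl a h z).
Proof.
move=> ha hh; have sN := bd_meas_sq_integ0Z hZ (bd_meas_dLnl ha hh).
by case: hh => h1 h2; split; apply: sq_integD => //; exact: isH2_sq_integ2.
Qed.

Lemma integ_dJ lam a h : isH2P2 Z a -> isH2P2 Z h ->
  integ mu D (dJ_integrand lam a h).
Proof.
move=> ha hh; have [s1 s2] := sq_integ_L ha; have [s3 s4] := sq_integ_dL ha hh.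
apply: integ_mul_wgt; apply: integD => //; apply: sq_integM => //; exact: sq_integZ.
Qed.

Lemma dJ_lin lam a t h h' : isH2P2 Z a -> isH2P2 Z h -> isH2P2 Z h' ->
  dJ lam a (t *: h + h') = t * dJ lam a h + dJ lam a h'.
Proof.
move=> ha hh hh'; have i1 := integ_dJ lam ha hh; have i2 := integ_dJ lam ha hh'.
rewrite /dJ -RintegralZl// -RintegralD//; last exact: integZ.
by apply: eq_Rintegral => z _; exact: dJ_integrand_lin.
Qed.

Lemma JlE lam a : Jl Z eps lam k a = \int[mu]_(z in D) J_integrand lam a z.
Proof. by []. Qed.

Lemma J_remainderE lam a h : isH2P2 Z a -> isH2P2 Z h ->
  integ mu D (fun z => remJ a h z * expR (- (2 * lam * z))) /\
  Jl Z eps lam k (a + h) - Jl Z eps lam k a - dJ lam a h =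
  \int[mu]_(z in D) (remJ a h z * expR (- (2 * lam * z))).
Proof.
move=> ha hh; have sm : submodule (isH2P2 Z) by case: (Pdot_semi_inner hZ).
have i0 := integ_J lam ha; have i1 := integ_J lam (submoduleD sm ha hh).
have i2 := integ_dJ lam ha hh.
have i10 := integB mD i1 i0.
have i102 := integB mD i10 i2.
have E : (fun z => remJ a h z * expR (- (2 * lam * z))) =
  (fun z => J_integrand lam (a + h) z - J_integrand lam a z - dJ_integrand lam a h z).
  by apply/funext => z; rewrite J_integrandD.
rewrite E; split => //.
by rewrite !JlE /dJ -RintegralB// -RintegralB.
Qed.

Context (K m : R).
Hypotheses (alK : 0 <= 2 * k / eps <= K) (beK : 0 <= (eps ^+ 2)^-1 <= K)
  (gaK : 0 <= 2 * Num.sqrt k <= K) (deK : 0 <= (eps * Num.sqrt k)^-1 <= K).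
Hypothesis m0 : 0 <= m.

Definition sup_cst := Num.sqrt (sobolev_cst Z) * m.
Notation M := sup_cst.
Notation A := (rem_cst K M).

Lemma sup_cst_ge0 : 0 <= M.
Proof. by rewrite mulr_ge0// sqrtr_ge0. Qed.

Lemma fd1_le_sup_cst a z : isH2P2 Z a -> Pdot Z a a <= m ^+ 2 -> D z ->
  `|fd1 a.1 z| <= M /\ `|fd1 a.2 z| <= M.
Proof.
move=> ha am; rewrite /= in_itv/= => z0Z.
have [d1 d2] := le_H2dot_Pdot hZ ha.
have c0 := ltW (sobolev_cst_gt0 hZ).
have aux u : isH2 Z u -> H2dot Z u u <= Pdot Z a a -> `|fd1 u z| <= M.
  move=> hu ua; rewrite -ler_sqr ?nnegrE ?sup_cst_ge0// real_normK ?num_real//.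
  rewrite exprMn sqr_sqrtr// (le_trans (sobolev1 hZ hu z0Z))// ler_wpM2l//.
  exact: le_trans am.
by case: ha => h1 h2; split; exact: aux.
Qed.

Lemma remJ_bounds a h z : isH2P2 Z a -> isH2P2 Z h ->
  Pdot Z a a <= m ^+ 2 -> Pdot Z h h <= m ^+ 2 -> D z ->
  let e := A * (1 + fd2 a.1 z ^+ 2 + fd2 a.2 z ^+ 2) *
           (fd1 h.1 z ^+ 2 + fd1 h.2 z ^+ 2) in
  (fd2 h.1 z ^+ 2 + fd2 h.2 z ^+ 2) / 2 - e <= remJ a h z /\
  `|remJ a h z| <= 2 * (fd2 h.1 z ^+ 2 + fd2 h.2 z ^+ 2) + e.
Proof.
move=> ha hh am hm Dz.
have [p1 p2] := fd1_le_sup_cst ha am Dz; have [p3 p4] := fd1_le_sup_cst hh hm Dz.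
have w0 : 0 <= fd1 h.1 z ^+ 2 + fd1 h.2 z ^+ 2 by rewrite addr_ge0 ?sqr_ge0.
exact: (remainder_bounds (fd2 a.1 z) (fd2 a.2 z) (fd2 h.1 z) (fd2 h.2 z)
  sup_cst_ge0 w0 (nl_part_le alK beK gaK deK p1 p2) (quad_part_le alK beK _ _)
  (incr_part_le alK beK gaK deK p1 p2 p3 p4)).
Qed.

Lemma integ_base_density a : isH2P2 Z a ->
  integ mu D (fun z => 1 + fd2 a.1 z ^+ 2 + fd2 a.2 z ^+ 2) /\
  \int[mu]_(z in D) (1 + fd2 a.1 z ^+ 2 + fd2 a.2 z ^+ 2) <= Z + Pdot Z a a.
Proof.
move=> [h1 h2]; have [_ s1] := isH2_sq_integ2 h1; have [_ s2] := isH2_sq_integ2 h2.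
have i1 := integ_cst0Z hZ 1.
have i2 := integD mD i1 s1.
split; first exact: integD.
rewrite RintegralD// RintegralD// Rintegral_itv_cst// mulr1 -addrA lerD2l.
by apply: lerD; exact: H2dot_ge_fd2.
Qed.

(** Sobolev bounds u'^2 + v'^2 uniformly by |h|^2, which leaves the density of the base point to be
    integrated. The weight is estimated by 1, so the constant is the same for all lambda > 0. *)
Lemma remainder_upper lam a h : 0 < lam -> isH2P2 Z a -> isH2P2 Z h ->
  Pdot Z a a <= m ^+ 2 -> Pdot Z h h <= m ^+ 2 ->
  `|Jl Z eps lam k (a + h) - Jl Z eps lam k a - dJ lam a h| <=
  (2 + A * sobolev_cst Z * (Z + m ^+ 2)) * Pdot Z h h.
Proof.
move=> lam0 ha hh am hm; have [ir ->] := J_remainderE lam ha hh.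
have A0 := rem_cst_ge0 alK sup_cst_ge0.
have [ib bZ] := integ_base_density ha.
have [_ s1] := isH2_sq_integ2 hh.1; have [_ s2] := isH2_sq_integ2 hh.2.
have is12 := integD mD s1 s2.
have c0 := ltW (sobolev_cst_gt0 hZ).
have P0 := Pdot_ge0 hZ hh.
set B := A * (sobolev_cst Z * Pdot Z h h).
have B0 : 0 <= B by rewrite !mulr_ge0.
apply: le_trans (le_normr_Rintegral _ ir) _ => //.
apply: (@le_trans _ _ (\int[mu]_(z in D) (2 * (fd2 h.1 z ^+ 2 + fd2 h.2 z ^+ 2)
    + B * (1 + fd2 a.1 z ^+ 2 + fd2 a.2 z ^+ 2)))).
  apply: le_Rintegral => //.
  - exact: integ_norm.
  - by apply: integD => //; exact: integZ.
  move=> z Dz; rewrite normrM [`|expR _|]ger0_norm ?expR_ge0//.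
  have [_ h1] := remJ_bounds ha hh am hm Dz.
  rewrite (@le_trans _ _ `|remJ a h z|)//.
    by rewrite ler_piMr// wgt_le1.
  rewrite (le_trans h1)// lerD2l /B mulrAC ler_wpM2r//.
    by rewrite !addr_ge0 ?sqr_ge0.
  rewrite ler_wpM2l// mulrDr.
  have z0Z : 0 <= z <= Z by move: Dz; rewrite /= in_itv.
  by apply: lerD; apply: sobolev1 => //; case: hh.
rewrite RintegralD//; [|exact: integZ|exact: integZ].
rewrite RintegralZl// RintegralZl// RintegralD// [leRHS]mulrDl.
apply: lerD.
  by rewrite ler_wpM2l//; apply: lerD; apply: H2dot_ge_fd2 => //; case: hh.
rewrite (_ : A * sobolev_cst Z * _ * _ = B * (Z + m ^+ 2)); last by rewrite /B; ring.
by rewrite ler_wpM2l// (le_trans bZ)// lerD2l.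
Qed.

(** The scheme of [remainder_upper] with Carleman in place of Sobolev, which gains the factor 1 / (2
    lam); u'(0) = v'(0) = 0 comes from H_0. *)
Lemma remainder_lower lam a h : 0 < lam -> isH2P2 Z a -> inH0 Z h ->
  Pdot Z a a <= m ^+ 2 -> Pdot Z h h <= m ^+ 2 ->
  (1 / 2 - A * (Z + m ^+ 2) / (2 * lam)) * (wgt lam (fd2 h.1) + wgt lam (fd2 h.2)) <=
  Jl Z eps lam k (a + h) - Jl Z eps lam k a - dJ lam a h.
Proof.
move=> lam0 ha h0 am hm; have hh := inH0_isH2P2 h0.
have [ir ->] := J_remainderE lam ha hh.
have A0 := rem_cst_ge0 alK sup_cst_ge0.
have [ib bZ] := integ_base_density ha.
have i1 := integ_wgt lam (isH2_sq_integ2 hh.1).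
have i2 := integ_wgt lam (isH2_sq_integ2 hh.2).
have l20 : 0 < 2 * lam by rewrite mulr_gt0.
have W0 f : 0 <= wgt lam f.
  by apply: Rintegral_ge0 => z _; rewrite mulr_ge0 ?sqr_ge0 ?expR_ge0.
set S := wgt lam _ + _.
have S0 : 0 <= S by rewrite addr_ge0.
set B := A * (S / (2 * lam)).
have B0 : 0 <= B by rewrite mulr_ge0// divr_ge0// ltW.
apply: (@le_trans _ _ (\int[mu]_(z in D) (
    2^-1 * (fd2 h.1 z ^+ 2 * expR (- (2 * lam * z)) + fd2 h.2 z ^+ 2 * expR (- (2 * lam * z)))
    - B * (1 + fd2 a.1 z ^+ 2 + fd2 a.2 z ^+ 2)))).
  rewrite RintegralB//; [|by apply: integZ => //; exact: integD|exact: integZ].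
  rewrite RintegralZl//; last exact: integD.
  rewrite RintegralD// -/(wgt lam (fd2 h.1)) -/(wgt lam (fd2 h.2)) -/S RintegralZl//.
  have := ler_wpM2l B0 (le_trans bZ (lerD (lexx Z) am)).
  move/(lerB (lexx (2^-1 * S))); apply: le_trans.
  by rewrite /B le_eqVlt; apply/orP; left; apply/eqP; field; rewrite gt_eqF.
apply: le_Rintegral => //.
  by apply: integB => //; [by apply: integZ => //; exact: integD|exact: integZ].
move=> z Dz; have [h1 _] := remJ_bounds ha hh am hm Dz.
have e0 := expR_ge0 (- (2 * lam * z)).
apply: le_trans (ler_wpM2r e0 h1).
have z0Z : 0 <= z <= Z by move: Dz; rewrite /= in_itv.
case: h0 => _ [_ [_ [u0 [_ [_ [v0 _]]]]]].
have c1 := carleman hZ lam0 (isH2_primitive1 hh.1) (isH2_sq_integ2 hh.1) u0 z0Z.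
have c2 := carleman hZ lam0 (isH2_primitive1 hh.2) (isH2_sq_integ2 hh.2) v0 z0Z.
have c12 : (fd1 h.1 z ^+ 2 + fd1 h.2 z ^+ 2) * expR (- (2 * lam * z)) <= S / (2 * lam).
  by rewrite /S mulrDl [leRHS]mulrDl; exact: lerD.
rewrite mulrBl; apply: lerB.
  by rewrite le_eqVlt; apply/orP; left; apply/eqP; field.
set g := 1 + _ + _.
rewrite -[leLHS]mulrA (_ : B * g = A * g * (S / (2 * lam))); last by rewrite /B; ring.
by rewrite ler_wpM2l// mulr_ge0// !addr_ge0 ?sqr_ge0.
Qed.

(** The weight is smallest at Z, and on H_0 the boundary terms of [H2dot_le] vanish. *)
Lemma wgt_ge lam h : 0 < lam -> inH0 Z h ->
  expR (- (2 * lam * Z)) / poincare_cst Z * Pdot Z h h <=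
  wgt lam (fd2 h.1) + wgt lam (fd2 h.2).
Proof.
move=> lam0 [h1 [h2 [u0 [u1 [_ [v0 [v1 _]]]]]]].
have p0 := poincare_cst_gt0 hZ.
have aux u : isH2 Z u -> fv u 0 = 0 -> fd1 u 0 = 0 ->
    expR (- (2 * lam * Z)) / poincare_cst Z * H2dot Z u u <= wgt lam (fd2 u).
  move=> hu e0 e1; have := H2dot_le hZ hu.
  rewrite e0 e1 expr0n !add0r => hd.
  have su := isH2_sq_integ2 hu; have iu := integ_wgt lam su; have [_ s2] := su.
  apply: (@le_trans _ _ (expR (- (2 * lam * Z)) * \int[mu]_(z in D) fd2 u z ^+ 2)).
    by rewrite -mulrA ler_wpM2l ?expR_ge0// mulrC ler_pdivrMr// mulrC.
  rewrite -RintegralZl//; apply: le_Rintegral => //; first exact: integZ.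
  move=> z; rewrite /= in_itv/= => /andP[_ zZ].
  rewrite mulrC ler_wpM2l ?sqr_ge0// ler_expR lerN2 ler_wpM2l// mulr_ge0//.
  exact: ltW.
by rewrite /Pdot mulrDr; apply: lerD; exact: aux.
Qed.

(** Products are split by 2 |X Y| <= X^2 + Y^2, hence the inhomogeneous form, which
    [le_snorm_of_quadratic] repairs. [C] may depend on [a]: it only serves the existence of the
    gradient. *)
Lemma dJ_bounded lam a : 0 < lam -> isH2P2 Z a -> Pdot Z a a <= m ^+ 2 ->
  exists2 C, 0 <= C & forall h, isH2P2 Z h -> `|dJ lam a h| <= C * (1 + Pdot Z h h).
Proof.
move=> lam0 ha am; have [[_ s1] [_ s2]] := sq_integ_L ha.
set c := 2 * lin_cst K M ^+ 2.
have c0 : 0 <= c by rewrite mulr_ge0// sqr_ge0.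
pose JJ := \int[mu]_(z in D) (L1 eps k a z ^+ 2 + L2 eps k a z ^+ 2).
have iJ := integD mD s1 s2.
have J0 : 0 <= JJ.
  by apply: Rintegral_ge0 => z _; rewrite addr_ge0 ?sqr_ge0.
pose e := 4 * c * sobolev_cst Z * Z.
have sc0 := ltW (sobolev_cst_gt0 hZ).
have e0 : 0 <= e by apply: mulr_ge0; [do 2![apply: mulr_ge0 => //]|exact: ltW].
exists (JJ + 2 + e); first by rewrite !addr_ge0.
move=> h hh; have id := integ_dJ lam ha hh.
have [_ t1] := isH2_sq_integ2 hh.1; have [_ t2] := isH2_sq_integ2 hh.2.
have P0 := Pdot_ge0 hZ hh.
have it := integD mD t1 t2.
have ic := integ_cst0Z hZ (4 * c * (sobolev_cst Z * Pdot Z h h)).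
have i1 := integZ mD 2 it.
have i2 := integD mD iJ i1.
apply: le_trans (le_normr_Rintegral _ id) _ => //.
apply: (@le_trans _ _ (\int[mu]_(z in D) ((L1 eps k a z ^+ 2 + L2 eps k a z ^+ 2)
   + 2 * (fd2 h.1 z ^+ 2 + fd2 h.2 z ^+ 2) + 4 * c * (sobolev_cst Z * Pdot Z h h)))).
  apply: le_Rintegral => //; [exact: integ_norm|exact: integD|].
  move=> z Dz; have [p1 p2] := fd1_le_sup_cst ha am Dz.
  have z0Z : 0 <= z <= Z by move: Dz; rewrite /= in_itv.
  have := lin_part_le alK beK gaK deK (fd1 h.1 z) (fd1 h.2 z) p1 p2.
  rewrite -/c -/(dLnl a h z).
  have : fd1 h.1 z ^+ 2 + fd1 h.2 z ^+ 2 <= sobolev_cst Z * Pdot Z h h.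
    by rewrite mulrDr; apply: lerD; apply: sobolev1 => //; case: hh.
  move=> /(ler_wpM2l c0) w1 /le_trans /(_ w1) {}w1.
  rewrite normrM [`|expR _|]ger0_norm ?expR_ge0//.
  apply: (@le_trans _ _ `|2 * L1 eps k a z * (fd2 h.1 z + dLnl a h z)
   + 2 * L2 eps k a z * (fd2 h.2 z + dLnl a h z)|).
    by rewrite ler_piMr// wgt_le1.
  move: w1; set d := dLnl a h z; set X := L1 eps k a z; set Y := L2 eps k a z.
  set x := fd2 h.1 z; set y := fd2 h.2 z; set w := sobolev_cst Z * _ => w1.
  have := sqr_ge0 (X - (x + d)); have := sqr_ge0 (X + (x + d)).
  have := sqr_ge0 (Y - (y + d)); have := sqr_ge0 (Y + (y + d)).
  have := sqr_ge0 (x - d); have := sqr_ge0 (y - d) => ? ? ? ? ? ?.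
  by rewrite ler_norml; apply/andP; split; nra.
rewrite RintegralD// RintegralD// -/JJ Rintegral_itv_cst// RintegralZl//.
rewrite [X in 2 * X]RintegralD//.
rewrite (_ : Z * (4 * c * _) = e * Pdot Z h h); last by rewrite /e; ring.
have : \int[mu]_(z in D) fd2 h.1 z ^+ 2 + \int[mu]_(z in D) fd2 h.2 z ^+ 2 <= Pdot Z h h.
  by apply: lerD; apply: H2dot_ge_fd2 => //; case: hh.
have := mulr_ge0 J0 P0; have := mulr_ge0 e0 P0.
set S := _ + _; move: J0 e0 P0; clearbody JJ e S => J0 e0 P0 ? ? ?.
by nra.
Qed.

End Functional.

(** * J on the ball *)

Section Ball.
Context {R : realType}.
Context (Z eps kmin kmax Rad : R) (hZ : 0 < Z) (heps : 0 < eps)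
  (hkmin : 0 < kmin) (hkk : kmin < kmax) (hR : 0 < Rad).
Implicit Types (a b d h : H2f R * H2f R) (lam k t : R).

(** The four coefficients at the endpoint where each is largest, added so that the sum dominates
    every one; 1/(eps sqrt k) decreases in k, hence kmin. *)
Definition coef_cst :=
  2 * kmax / eps + (eps ^+ 2)^-1 + 2 * Num.sqrt kmax + (eps * Num.sqrt kmin)^-1.

Lemma coef_bounds k : kmin <= k <= kmax ->
  [/\ 0 <= 2 * k / eps <= coef_cst, 0 <= (eps ^+ 2)^-1 <= coef_cst,
      0 <= 2 * Num.sqrt k <= coef_cst & 0 <= (eps * Num.sqrt k)^-1 <= coef_cst].
Proof.
move=> /andP[k1 k2].
have k0 : 0 < k := lt_le_trans hkmin k1.
have s0 : 0 < Num.sqrt kmin by rewrite sqrtr_gt0.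
have sk0 : 0 < Num.sqrt k by rewrite sqrtr_gt0.
have a1 : 0 <= 2 * k / eps by rewrite divr_ge0 ?mulr_ge0 ?ltW.
have a2 : 2 * k / eps <= 2 * kmax / eps by rewrite ler_pM2r ?invr_gt0// ler_pM2l.
have b1 : 0 <= (eps ^+ 2)^-1 by rewrite invr_ge0 sqr_ge0.
have c1 : 0 <= 2 * Num.sqrt k by rewrite mulr_ge0// sqrtr_ge0.
have c2 : 2 * Num.sqrt k <= 2 * Num.sqrt kmax by rewrite ler_pM2l// ler_wsqrtr.
have d1 : 0 <= (eps * Num.sqrt k)^-1 by rewrite invr_ge0 mulr_ge0 ?sqrtr_ge0// ltW.
have d2 : (eps * Num.sqrt k)^-1 <= (eps * Num.sqrt kmin)^-1.
  by rewrite lef_pV2 ?posrE ?mulr_gt0// ler_pM2l// ler_wsqrtr.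
by rewrite /coef_cst; split; apply/andP; split => //; lra.
Qed.

Notation K := coef_cst.
Notation m := (4 * Rad).
Notation A := (rem_cst K (sup_cst Z m)).

Let m0 : 0 <= m. Proof. by rewrite mulr_ge0// ltW. Qed.

Let K_ge0 : 0 <= K.
Proof.
have kk : kmin <= kmin <= kmax by rewrite lexx ltW.
by have [_ /andP[h1 h2] _ _] := coef_bounds kk; exact: le_trans h2.
Qed.

Let A_ge0 : 0 <= A.
Proof.
have KK : 0 <= (0 : R) <= K by apply/andP.
apply: (rem_cst_ge0 KK); exact: sup_cst_ge0.
Qed.

Definition quad_cst := 2 + A * sobolev_cst Z * (Z + m ^+ 2).

Lemma quad_cst_gt0 : 0 < quad_cst.
Proof.
rewrite ltr_wpDr// mulr_ge0//; last by rewrite addr_ge0 ?sqr_ge0// ltW.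
by rewrite mulr_ge0// ltW// sobolev_cst_gt0.
Qed.

Lemma PsnormE a : snorm (Pdot Z) a = Pnorm Z a. Proof. by []. Qed.

Lemma H2snormE (u : H2f R) : snorm (H2dot Z) u = H2norm Z u. Proof. by []. Qed.

Let iP := Pdot_semi_inner hZ.
Let iH : semi_inner (isH2 Z : set (H2f R)) (H2dot Z) := H2_semi_inner hZ.
Let sP : submodule (isH2P2 Z). Proof. by case: iP. Qed.
Let sH0 : submodule (inH0 Z : set (H2f R * H2f R)) := inH0_submodule hZ.
Let H0P : (inH0 Z : set (H2f R * H2f R)) `<=` isH2P2 Z.
Proof. by move=> h; exact: inH0_isH2P2. Qed.

Lemma sqr_Pnorm a : isH2P2 Z a -> Pnorm Z a ^+ 2 = Pdot Z a a.
Proof. exact: sqr_snorm. Qed.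

Lemma Pdot_le_of_Pnorm a c : isH2P2 Z a -> Pnorm Z a <= c -> Pdot Z a a <= c ^+ 2.
Proof.
move=> ha ac; rewrite -sqr_Pnorm// lerXn2r ?nnegrE//; first exact: snorm_ge0.
exact: le_trans (snorm_ge0 _ _) ac.
Qed.

Section FixedData.
Context (g dg : R -> R) (k : R) (kP : kmin <= k <= kmax).
Notation ball := (cBall Z eps g dg k Rad).

Lemma cBall_isH2P2 a : ball a -> isH2P2 Z a.
Proof. by case=> h1 [h2 _]; split. Qed.

Lemma cBall_Pnorm a : ball a -> Pnorm Z a <= Rad.
Proof.
move=> aB; have ha := cBall_isH2P2 aB; case: aB => h1 [h2 [_ aR]].
have e1 : H2norm Z a.1 ^+ 2 = H2dot Z a.1 a.1 by exact: (sqr_snorm iH h1).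
have e2 : H2norm Z a.2 ^+ 2 = H2dot Z a.2 a.2 by exact: (sqr_snorm iH h2).
have n1 : 0 <= H2norm Z a.1 := snorm_ge0 _ _.
have n2 : 0 <= H2norm Z a.2 := snorm_ge0 _ _.
rewrite -ler_sqr ?nnegrE ?(ltW hR)//; last exact: snorm_ge0.
rewrite sqr_Pnorm// /Pdot -e1 -e2.
by have := mulr_ge0 n1 n2; nra.
Qed.

Lemma cBall_sub_inH0 a b : ball a -> ball b -> inH0 Z (b - a).
Proof.
move=> aB bB; have [h1 h2] := submoduleB sP (cBall_isH2P2 bB) (cBall_isH2P2 aB).
case: aB => _ [_ [[a1 [a2 [a3 [a4 [a5 a6]]]]] _]].
case: bB => _ [_ [[b1 [b2 [b3 [b4 [b5 b6]]]]] _]].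
by do 2 (split=> //); rewrite /= a1 a2 a3 a4 a5 a6 b1 b2 b3 b4 b5 b6 !subrr.
Qed.

Lemma cBall_sub_Pnorm a b : ball a -> ball b -> Pnorm Z (b - a) <= 2 * Rad.
Proof.
move=> aB bB; have aR := cBall_Pnorm aB; have bR := cBall_Pnorm bB.
have ha := cBall_isH2P2 aB; have hb := cBall_isH2P2 bB.
have := ler_snormD iP hb (submoduleN sP ha).
rewrite -[- a]scaleN1r (snormZ iP _ ha) normrN1 mul1r scaleN1r !PsnormE.
lra.
Qed.

Lemma cBall_convex a b t : ball a -> ball b -> 0 <= t <= 1 ->
  ball (a + t *: (b - a)).
Proof.
move=> aB bB t01; have ha := cBall_isH2P2 aB; have hb := cBall_isH2P2 bB.
have [h1 h2] := submoduleD sP ha (submoduleZ sP t (submoduleB sP hb ha)).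
case: aB => p1 [p2 [[a1 [a2 [a3 [a4 [a5 a6]]]]] aR]].
case: bB => q1 [q2 [[b1 [b2 [b3 [b4 [b5 b6]]]]] bR]].
split; [exact: h1|split; [exact: h2|split]].
  rewrite /BC /= a1 a2 a3 a4 a5 a6 b1 b2 b3 b4 b5 b6 !subrr !mulr0 !addr0.
  by [].
have /andP[t0 t1] := t01.
have n1 := snorm_convex iH p1 q1 t01; have n2 := snorm_convex iH p2 q2 t01.
apply: le_trans (lerD n1 n2) _.
rewrite !H2snormE addrACA -!mulrDr.
have := ler_wpM2l t0 bR; have := ler_wpM2l _ aR; move=> /(_ (1 - t)).
rewrite subr_ge0 => /(_ t1); lra.
Qed.

Lemma cBall_complete : seq_complete (Pdot Z) ball.
Proof.
move=> x xB dx; have hx n := cBall_isH2P2 (xB n).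
have [y hy yx] := P_complete hZ hx dx; exists y => //.
have Z00 : 0 <= (0 : R) <= Z by rewrite lexx ltW.
have ZZ : 0 <= Z <= Z by rewrite lexx ltW.
have hd n : isH2P2 Z (y - x n) by exact: (submoduleB sP).
split; [exact: hy.1|split; [exact: hy.2|split]].
  have p := limit_point_value hZ hy hx yx Z00; have q := limit_point_value hZ hy hx yx ZZ.
  refine (conj _ (conj _ (conj _ (conj _ (conj _ _))))).
  - by have [H _ _ _] := p 0; apply: H => n; case: (xB n) => _ [_ [[]]].
  (* The prescribed value of q'(0) is named through the first term of the sequence, since all terms
     share it. *)
  - have [_ H _ _] := p (fd1 (x 0%N).1 0); rewrite H.
      by case: (xB 0%N) => _ [_ [[_ []]]].
    move=> n; case: (xB n) => _ [_ [[_ [-> _]] _]].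
    by case: (xB 0%N) => _ [_ [[_ [-> _]] _]].
  - by have [_ H _ _] := q 0; apply: H => n; case: (xB n) => _ [_ [[_ [_ []]]]].
  - by have [_ _ H _] := p (- eps); apply: H => n; case: (xB n) => _ [_ [[_ [_ [_ []]]]]].
  - have [_ _ _ H] := p (fd1 (x 0%N).2 0); rewrite H.
      by case: (xB 0%N) => _ [_ [[_ [_ [_ [_ []]]]]]].
    move=> n; case: (xB n) => _ [_ [[_ [_ [_ [_ [-> _]]]]] _]].
    by case: (xB 0%N) => _ [_ [[_ [_ [_ [_ [-> _]]]]] _]].
  - by have [_ _ _ H] := q 0; apply: H => n; case: (xB n) => _ [_ [[_ [_ [_ [_ [_ ]]]]]]].
apply/ler_addgt0Pr => e e0.
have e20 : 0 < e / 2 by rewrite divr_gt0.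
have [N /(_ N (leqnn N)) HN] := yx _ (exprn_gt0 2 e20).
have [d1 d2] := le_H2dot_Pdot hZ (hd N).
have small u : isH2 Z u -> H2dot Z u u <= Pdot Z (y - x N) (y - x N) -> H2norm Z u <= e / 2.
  move=> hu du; rewrite -ler_sqr ?nnegrE ?(ltW e20)//; last exact: snorm_ge0.
  by rewrite (sqr_snorm iH hu) (le_trans du)// ltW.
have s1 := small _ (hd N).1 d1; have s2 := small _ (hd N).2 d2.
have t1 := ler_snormD iH (hd N).1 (hx N).1; have t2 := ler_snormD iH (hd N).2 (hx N).2.
rewrite [(y - x N).1 + _]subrK !H2snormE in t1.
rewrite [(y - x N).2 + _]subrK !H2snormE in t2.
case: (xB N) => _ [_ [_ xR]].
lra.
Qed.

Section FixedWeight.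
Context (lam : R) (lam0 : 0 < lam).
Notation J := (Jl Z eps lam k).
Notation l := (dJ Z eps k lam).

Let coefs := coef_bounds kP.

Lemma Rad2_le_m2 : Rad ^+ 2 <= m ^+ 2.
Proof. by rewrite lerXn2r ?nnegrE ?(ltW hR)//; have := hR; lra. Qed.

Lemma cBall_Pdot a : ball a -> Pdot Z a a <= m ^+ 2.
Proof.
move=> aB; apply: le_trans Rad2_le_m2.
exact: Pdot_le_of_Pnorm (cBall_isH2P2 aB) (cBall_Pnorm aB).
Qed.

Lemma J_quadratic_expansion a h : ball a -> inH0 Z h -> Pnorm Z h <= m ->
  `|J (a + h) - J a - l a h| <= quad_cst * Pdot Z h h.
Proof.
move=> aB h0 hm; have [c1 c2 c3 c4] := coefs.
apply: (remainder_upper hZ c1 c2 c3 c4 m0 lam0 (cBall_isH2P2 aB)) => //.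
- exact: inH0_isH2P2.
- exact: cBall_Pdot.
- by apply: Pdot_le_of_Pnorm => //; exact: inH0_isH2P2.
Qed.

Lemma gradient_exists a : ball a ->
  exists2 d, inH0 Z d & forall h, inH0 Z h -> Pdot Z d h = l a h.
Proof.
move=> aB; have ha := cBall_isH2P2 aB.
have [c1 c2 c3 c4] := coefs.
have [C C0 lC] := dJ_bounded hZ c1 c2 c3 c4 m0 lam0 ha (cBall_Pdot aB).
have lin t u v : inH0 Z u -> inH0 Z v -> l a (t *: u + v) = t * l a u + l a v.
  by move=> hu hv; apply: dJ_lin => //; exact: inH0_isH2P2.
have iH0 := semi_inner_sub iP sH0 H0P.
apply: (riesz iH0 (C := 2 * C)) => //; first exact: inH0_complete.
have l0 : l a 0 = 0.
  have := lin 1 0 0 (submodule0 sH0) (submodule0 sH0).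
  by rewrite scaler0 addr0 mul1r => e; apply: (addIr (l a 0)); rewrite add0r -e.
apply: (le_snorm_of_quadratic iH0 C0).
  by move=> t u hu; have := lin t u 0 hu (submodule0 sH0); rewrite l0 !addr0.
by move=> u hu; apply: lC; exact: inH0_isH2P2.
Qed.

Lemma isFDer_exists a : ball a -> exists d, isFDer Z eps lam k a d.
Proof.
move=> aB; have [d d0 dl] := gradient_exists aB; exists d; split=> // e e0.
have q0 := quad_cst_gt0; have mpos : 0 < m by rewrite mulr_gt0.
exists (Num.min m (e / quad_cst)); split; first by rewrite lt_min mpos divr_gt0.
move=> h h0; rewrite lt_min => /andP[hm he].
have := J_quadratic_expansion aB h0 (ltW hm).
rewrite -dl// -sqr_Pnorm; last exact: inH0_isH2P2.
move/le_trans; apply; rewrite expr2 mulrA ler_wpM2r//; first exact: snorm_ge0.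
by rewrite mulrC -ler_pdivlMr// ltW.
Qed.

(** The theorem speaks of any [d] satisfying [isFDer]; uniqueness of the derivative transfers the
    explicit formula [dJ] to it. *)
Lemma isFDer_dJ a d : ball a -> isFDer Z eps lam k a d ->
  forall h, inH0 Z h -> Pdot Z d h = l a h.
Proof.
move=> aB [d0 Fd] h h0; have [d' d'0 dl] := gradient_exists aB.
rewrite -dl//; have mpos : 0 < m by rewrite mulr_gt0.
apply: (frechet_unique iP sH0 H0P mpos quad_cst_gt0 d'0 d0 _ Fd h0).
by move=> u u0 um; rewrite dl//; exact: J_quadratic_expansion.
Qed.

Lemma isFDer_lipschitz a1 a2 d1 d2 : ball a1 -> ball a2 ->
  isFDer Z eps lam k a1 d1 -> isFDer Z eps lam k a2 d2 ->
  Pnorm Z (d2 - d1) <= 8 * quad_cst * Pnorm Z (a2 - a1).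
Proof.
(* Ball elements differ by at most 2 Rad, and a test increment up to 2 Rad is added to the
   difference; this fixes the range 4 Rad of the expansions. *)
move=> B1 B2 D1 D2; have R2 : 0 < 2 * Rad by rewrite mulr_gt0.
have expand a d h : ball a -> isFDer Z eps lam k a d -> inH0 Z h ->
    snorm (Pdot Z) h <= 2 * (2 * Rad) ->
    `|J (a + h) - J a - Pdot Z d h| <= quad_cst * Pdot Z h h.
  move=> aB Da h0 hm; rewrite (isFDer_dJ aB Da)//.
  by apply: J_quadratic_expansion => //; rewrite -PsnormE; lra.
apply: (gradient_lipschitz iP (F := J) sH0 H0P quad_cst_gt0 R2).
- exact: cBall_isH2P2 B1.
- exact: cBall_isH2P2 B2.
- exact: cBall_sub_inH0.
- by case: D1.
- by case: D2.
- exact: cBall_sub_Pnorm.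
- by move=> h h0; exact: expand.
- by move=> h h0; exact: expand.
Qed.

(** Makes the loss A (Z + m^2) / (2 lam) at most 1/4, so that 1/4 of the principal term survives;
    that 1/4 divided by the constant of [wgt_ge] is [convexity_cst]. *)
Definition lam_min := 1 + 2 * A * (Z + m ^+ 2).
Definition convexity_cst := (4 * poincare_cst Z)^-1.

Lemma lam_min_ge1 : 1 <= lam_min.
Proof. by rewrite lerDl mulr_ge0 ?mulr_ge0// addr_ge0 ?sqr_ge0// ltW. Qed.

Lemma convexity_cst_gt0 : 0 < convexity_cst.
Proof. by rewrite invr_gt0 mulr_gt0// poincare_cst_gt0. Qed.

Section LargeWeight.
Hypothesis lamP : lam_min <= lam.

Let cvx := convexity_cst * expR (- (2 * lam * Z)).

Let cvx_gt0 : 0 < cvx.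
Proof. by rewrite mulr_gt0 ?convexity_cst_gt0 ?expR_gt0. Qed.

Lemma J_strong_convexity a b : ball a -> ball b ->
  convexity_cst * expR (- (2 * lam * Z)) * Pdot Z (b - a) (b - a) <=
  J b - J a - l a (b - a).
Proof.
move=> aB bB; have [c1 c2 c3 c4] := coefs.
have h0 := cBall_sub_inH0 aB bB; have hh := inH0_isH2P2 h0.
have hm : Pdot Z (b - a) (b - a) <= m ^+ 2.
  apply: Pdot_le_of_Pnorm => //; apply: le_trans (cBall_sub_Pnorm aB bB) _.
  by have := hR; lra.
have := remainder_lower hZ c1 c2 c3 c4 m0 lam0 (cBall_isH2P2 aB) h0 (cBall_Pdot aB) hm.
rewrite [a + _]addrC subrK; apply: le_trans.
have p0 := poincare_cst_gt0 hZ.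
apply: (@le_trans _ _ (1 / 4 * (wgt Z lam (fd2 (b - a).1) + wgt Z lam (fd2 (b - a).2)))).
  apply: le_trans (ler_wpM2l _ (wgt_ge hZ lam0 h0)); last by rewrite divr_ge0.
  by rewrite /convexity_cst le_eqVlt; apply/orP; left; apply/eqP; field; rewrite gt_eqF.
apply: ler_wpM2r.
  by apply: le_trans (wgt_ge hZ lam0 h0); rewrite mulr_ge0 ?divr_ge0 ?expR_ge0 ?(ltW p0)// Pdot_ge0.
have : A * (Z + m ^+ 2) / (2 * lam) <= 1 / 4.
  rewrite ler_pdivrMr ?mulr_gt0//; move: lamP; rewrite /lam_min -mulrA; lra.
lra.
Qed.

(** Add strong convexity from the midpoint towards [a] and towards [b]: the increments are opposite,
    so the derivative terms cancel, and each has squared length a quarter of that of a - b. *)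
Lemma J_midpoint a b : ball a -> ball b ->
  ball (2^-1 *: (a + b)) /\
  J (2^-1 *: (a + b)) <= (J a + J b) / 2 - cvx / 4 * Pdot Z (a - b) (a - b).
Proof.
move=> aB bB; have ha := cBall_isH2P2 aB; have hb := cBall_isH2P2 bB.
have half2 : 2^-1 + 2^-1 = 1 :> R by lra.
have aE : a = 2^-1 *: a + 2^-1 *: a by rewrite -scalerDl half2 scale1r.
have bE : b = 2^-1 *: b + 2^-1 *: b by rewrite -scalerDl half2 scale1r.
set c := 2^-1 *: (a + b).
have am : a - c = 2^-1 *: (a - b).
  by rewrite {1}aE /c scalerDr scalerBr opprD addrACA subrr add0r.
have bm : b - c = - (2^-1 *: (a - b)).
  rewrite {1}bE /c scalerDr scalerBr opprD opprB.
  by rewrite [- (_ *: a) - _]addrC addrACA subrr add0r.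
have cB : ball c.
  rewrite (_ : c = a + 2^-1 *: (b - a)).
    by apply: cBall_convex => //; apply/andP; split; lra.
  by rewrite -[b - a]opprB scalerN -am opprB [a + _]addrC subrK.
split=> //.
have s1 := J_strong_convexity cB aB; have s2 := J_strong_convexity cB bB.
have [d d0 dl] := gradient_exists cB.
have ac0 := cBall_sub_inH0 cB aB; have bc0 := cBall_sub_inH0 cB bB.
have hd := inH0_isH2P2 d0; have hab := submoduleB sP ha hb.
have hab2 := submoduleZ sP 2^-1 hab.
have l0 : l c (a - c) + l c (b - c) = 0.
  have -> : b - c = -1 *: (a - c) by rewrite bm am scaleN1r.
  rewrite -!dl//; last exact: submoduleZ.
  by rewrite (sdotZr iP) ?mulN1r ?subrr//; exact: inH0_isH2P2.
have e1 : Pdot Z (a - c) (a - c) = Pdot Z (a - b) (a - b) / 4.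
  by rewrite am (sdotZZ iP)//; field.
have e2 : Pdot Z (b - c) (b - c) = Pdot Z (a - b) (a - b) / 4.
  by rewrite bm -scaleN1r (sdotZZ iP)// (sdotZZ iP)//; field.
rewrite -/cvx e1 in s1; rewrite -/cvx e2 in s2.
move: l0; rewrite addrC => /eqP; rewrite addr_eq0 => /eqP l0.
rewrite l0 in s2; lra.
Qed.

Lemma minimizer_exists : (exists a, ball a) ->
  exists2 a, ball a & forall b, ball b -> J a <= J b.
Proof.
move=> [a0 a0B].
apply: (midpoint_minimizer (W := isH2P2 Z) (m0 := 0) (c := cvx / 4)).
- by move=> a; exact: cBall_isH2P2.
- by exists a0.
- by rewrite divr_gt0.
- move=> a _; apply: Rintegral_ge0 => z _.
  by rewrite mulr_ge0 ?expR_ge0// addr_ge0 ?sqr_ge0.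
- exact: J_midpoint.
- exact: cBall_complete.
(* Lower semicontinuity from convexity: J lies above its tangent at [a], so J a - J b <= |d| |b -
   a|. *)
move=> a aB e e0; have [d d0 dl] := gradient_exists aB.
have hd := inH0_isH2P2 d0; have ha := cBall_isH2P2 aB.
have nd0 : 0 <= Pnorm Z d := snorm_ge0 _ _.
have nd1 : 0 < Pnorm Z d + 1 by rewrite ltr_wpDl.
exists ((e / (Pnorm Z d + 1)) ^+ 2); first by rewrite exprn_gt0// divr_gt0.
move=> b bB hb; have hb2 := cBall_isH2P2 bB.
have hba := submoduleB sP hb2 ha.
have s := J_strong_convexity aB bB.
have s0 : 0 <= cvx * Pdot Z (b - a) (b - a) by rewrite mulr_ge0 ?(ltW cvx_gt0)// Pdot_ge0.
have ba0 := cBall_sub_inH0 aB bB.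
rewrite -dl// in s.
have := le_sdot_snorm iP hd hba; rewrite !PsnormE ler_norml => /andP[h _].
have nb : Pnorm Z (b - a) <= e / (Pnorm Z d + 1).
  rewrite -ler_sqr ?nnegrE ?snorm_ge0 ?divr_ge0 ?ltW// sqr_Pnorm//.
  by rewrite (sdot_subC iP)// ltW.
have hn : Pnorm Z d * Pnorm Z (b - a) <= e.
  rewrite ler_pdivlMr// in nb.
  have : 0 <= Pnorm Z (b - a) := snorm_ge0 _ _; nra.
rewrite -/cvx in s; lra.
Qed.

Lemma minimizer_unique a b : ball a -> ball b ->
  (forall c, ball c -> J a <= J c) -> (forall c, ball c -> J b <= J c) ->
  Pnorm Z (b - a) = 0.
Proof.
move=> aB bB aM bM; have [cB cJ] := J_midpoint bB aB.
have h := aM _ cB; have h' := bM _ aB.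
have hba := submoduleB sP (cBall_isH2P2 bB) (cBall_isH2P2 aB).
have P0 := Pdot_ge0 hZ hba.
apply/eqP; rewrite sqrtr_eq0.
have : cvx / 4 * Pdot Z (b - a) (b - a) <= 0 by lra.
by rewrite pmulr_rle0// divr_gt0.
Qed.

End LargeWeight.

(** Along the segment from [a] to [b], minimality and the quadratic expansion give 0 <= t [d, h] + C
    t^2; divide by t and let t tend to 0. *)
Lemma variational_inequality a d b : ball a -> (forall c, ball c -> J a <= J c) ->
  isFDer Z eps lam k a d -> ball b -> 0 <= Pdot Z d (b - a).
Proof.
move=> aB aM Da bB; have h0 := cBall_sub_inH0 aB bB; set h := b - a in h0 *.
have hh := inH0_isH2P2 h0; have P0 := Pdot_ge0 hZ hh.
have hd : isH2P2 Z d by case: Da => /inH0_isH2P2.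
set C := quad_cst * Pdot Z h h.
have C0 : 0 <= C by rewrite mulr_ge0// ltW// quad_cst_gt0.
have step t : 0 < t -> t <= 1 -> - (C * t) <= Pdot Z d h.
  move=> t0 t1; have t01 : 0 <= t <= 1 by rewrite ltW.
  have th0 := submoduleZ sH0 t h0.
  have thm : Pnorm Z (t *: h) <= m.
    rewrite -PsnormE (snormZ iP)// ger0_norm ?ltW// PsnormE.
    have := cBall_sub_Pnorm aB bB; rewrite -/h.
    have : 0 <= Pnorm Z h := snorm_ge0 _ _; have := hR; nra.
  have := J_quadratic_expansion aB th0 thm.
  rewrite -(isFDer_dJ aB Da)// (sdotZr iP)// (sdotZZ iP)// ler_norml => /andP[_ e].
  have := aM _ (cBall_convex aB bB t01); rewrite -/h => J1.
  rewrite -(ler_pM2l t0) /C; nra.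
rewrite -oppr_le0; apply/ler_addgt0Pr => e e0; rewrite add0r.
pose t := Num.min 1 (e / (C + 1)).
have C1 : 0 < C + 1 by rewrite ltr_wpDl.
have t0 : 0 < t by rewrite lt_min ltr01 divr_gt0.
have := step t t0; rewrite ge_min lexx => /(_ isT).
have : t * (C + 1) <= e by rewrite -ler_pdivlMr// ge_min lexx orbT.
by rewrite lerNl; nra.
Qed.

End FixedWeight.
End FixedData.
End Ball.

Theorem theorem5p1 (R : realType) (Z eps kmin kmax Rad : R)
  (hZ : 0 < Z) (heps : 0 < eps) (hkmin : 0 < kmin) (hkk : kmin < kmax)
  (hR : 0 < Rad) :
  (* part 1 *)
  (forall g dg : R -> R, C1_on kmin kmax g dg ->
   forall lam k : R, 0 < lam -> kmin <= k <= kmax ->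
     (forall a : Pair, cBall Z eps g dg k Rad a ->
        exists d : Pair, isFDer Z eps lam k a d) /\
     (exists D : R, 0 < D /\
        forall a1 a2 d1 d2 : Pair,
          cBall Z eps g dg k Rad a1 -> cBall Z eps g dg k Rad a2 ->
          isFDer Z eps lam k a1 d1 -> isFDer Z eps lam k a2 d2 ->
          Pnorm Z (Psub d2 d1) <= D * Pnorm Z (Psub a2 a1))) /\
  (* parts 2 and 3: lambda_1, C_1 depend only on Rad, Z, kmin, kmax, eps *)
  (exists lam1 C1 : R, 1 <= lam1 /\ 0 < C1 /\
   forall g dg : R -> R, C1_on kmin kmax g dg ->
   forall lam k : R, lam1 <= lam -> kmin <= k <= kmax ->
     (* part 2: strong convexity *)
     (forall a1 a2 d1 : Pair,
        cBall Z eps g dg k Rad a1 -> cBall Z eps g dg k Rad a2 ->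
        isFDer Z eps lam k a1 d1 ->
        Jl Z eps lam k a2 - Jl Z eps lam k a1 - Pdot Z d1 (Psub a2 a1)
          >= C1 * expR (- (2 * lam * Z)) * Pnorm Z (Psub a2 a1) ^+ 2) /\
     (* part 3: unique minimizer and variational inequality *)
     ((exists a : Pair, cBall Z eps g dg k Rad a) ->
      exists amin : Pair,
        cBall Z eps g dg k Rad amin /\
        (forall a, cBall Z eps g dg k Rad a ->
           Jl Z eps lam k amin <= Jl Z eps lam k a) /\
        (forall b, cBall Z eps g dg k Rad b ->
           (forall a, cBall Z eps g dg k Rad a ->
              Jl Z eps lam k b <= Jl Z eps lam k a) ->
           Pnorm Z (Psub b amin) = 0) /\
        (forall d : Pair, isFDer Z eps lam k amin d ->
           forall a, cBall Z eps g dg k Rad a ->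
             0 <= Pdot Z d (Psub a amin)))).
Proof.
split=> [g dg _ lam k lam0 kP|].
  split=> [a aB|]; first exact: (isFDer_exists hZ heps hkmin hkk hR kP lam0 aB).
  (* This Lipschitz constant is uniform in g, k and lambda. *)
  exists (8 * quad_cst Z eps kmin kmax Rad); split.
    by rewrite mulr_gt0// quad_cst_gt0.
  move=> a1 a2 d1 d2 B1 B2 D1 D2.
  exact: (isFDer_lipschitz hZ heps hkmin hkk hR kP lam0 B1 B2 D1 D2).
exists (lam_min Z eps kmin kmax Rad), (convexity_cst Z).
have lam_ge1 := lam_min_ge1 hZ heps hkmin hkk hR.
split=> //; split; first exact: convexity_cst_gt0.
move=> g dg _ lam k lamP kP.
have lam0 : 0 < lam by rewrite (lt_le_trans ltr01)// (le_trans lam_ge1).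
split=> [a1 a2 d1 B1 B2 D1|ne].
  have h0 := cBall_sub_inH0 hZ B1 B2.
  rewrite PsubE sqr_Pnorm//; last exact: inH0_isH2P2.
  rewrite (isFDer_dJ hZ heps hkmin hkk hR kP lam0 B1 D1)//.
  exact: (J_strong_convexity hZ heps hkmin hR kP lam0 lamP B1 B2).
have [a aB aM] := minimizer_exists hZ heps hkmin hR kP lam0 lamP ne.
exists a; split=> //; split=> //; split=> [b bB bM|d Da b bB].
  exact: (minimizer_unique hZ heps hkmin hR kP lam0 lamP aB bB aM bM).
exact: (variational_inequality hZ heps hkmin hkk hR kP lam0 aB aM Da bB).
Qed.
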